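(* Let $r\ge k\ge1$ and $m\ge1$ be integers, let $S\subseteq\{1,\ldots,r\}$, $T=\{1,\ldots,r\}\setminus S$, and let $\pi=\{B_1,\ldots,B_k\}$ be a partition of $S$ into $k$ blocks, each of which has one or two elements. For $i\in S$ let $l_i$ be the index with $i\in B_{l_i}$. Let $X=(X_{i,\vec j})$, $i\in\{1,\ldots,r\}$, $\vec j=(j_1,\ldots,j_k)\in\{1,\ldots,m\}^k$, be elements of a $C^*$-algebra $\mathcal A$ such that for $i\in S$, $X_{i,\vec j}$ depends only on $(i,j_{l_i})$. If $X$ is open for $\pi$, then $$\left\|\sum_{\vec j\in\{1,\ldots,m\}^k}X_{1,\vec j}X_{2,\vec j}\cdots X_{r,\vec j}\right\|\le\prod_{i=1}^rQ_{\pi,i}.$$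
   Context: For $i\in S$ and $j\in\{1,\ldots,m\}$, $X_{i,j}$ denotes the common value of $X_{i,\vec j}$ over all $\vec j$ with $j_{l_i}=j$. For $i\in T$, the block $B_l$ is open at $i$ if $\min B_l<i<\max B_l$. $X$ is open for $\pi$ if for every $i\in T$ the map $\vec j\mapsto X_{i,\vec j}$ depends only on the coordinates $j_l$ for which $B_l$ is open at $i$. The numbers $Q_{\pi,i}\ge0$ are defined by: (1) if $i\in T$, $Q_{\pi,i}=\max_{\vec j}\|X_{i,\vec j}\|$; (2) if $i\in S$ is the smallest element of a block with two elements, $Q_{\pi,i}=\big\|\sum_{j=1}^mX_{i,j}X_{i,j}^*\big\|^{1/2}$; (3) if $i\in S$ is the largest element of a block with two elements, $Q_{\pi,i}=\big\|\sum_{j=1}^mX_{i,j}^*X_{i,j}\big\|^{1/2}$; (4) if $\{i\}$ is a singleton block, $Q_{\pi,i}=\big\|\sum_{j=1}^m\sqrt{X_{i,j}X_{i,j}^*}\big\|^{1/2}\cdot\big\|\sum_{j=1}^m\sqrt{X_{i,j}^*X_{i,j}}\big\|^{1/2}$. *)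

(* Defs.v *)
From HB Require Import structures.
From mathcomp Require Import all_boot all_order all_algebra.
From mathcomp Require Import complex.
From mathcomp Require Import boolp classical_sets reals topology normedtype.

Set Implicit Arguments.
Unset Strict Implicit.
Unset Printing Implicit Defensive.

Import Order.TTheory GRing.Theory Num.Theory.
Import numFieldNormedType.Exports.

Local Open Scope ring_scope.
Local Open Scope complex_scope.

(* C*-algebras over the complex numbers R[i]. No unit is assumed, which is why
   the product is a separate operation rather than the one of an algType. *)
HB.mixin Record isCStarAlgebra (R : realType) A
    of CompleteNormedModule R[i] A := {
  cmul : A -> A -> A;
  star : A -> A;
  cmulA : associative cmul;
  cmulDl : left_distributive cmul +%R;
  cmulDr : right_distributive cmul +%R;
  cmulZl : forall (a : R[i]) (x y : A), cmul (a *: x) y = a *: cmul x y;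
  cmulZr : forall (a : R[i]) (x y : A), cmul x (a *: y) = a *: cmul x y;
  starK : involutive star;
  starD : {morph star : x y / x + y};
  starZ : forall (a : R[i]) (x : A), star (a *: x) = Num.conj a *: star x;
  starM : forall x y : A, star (cmul x y) = cmul (star y) (star x);
  norm_cmul : forall x y : A, `|cmul x y| <= `|x| * `|y|;
  norm_starM : forall x : A, `|cmul (star x) x| = `|x| ^+ 2 }.

#[short(type="cstarAlgType")]
HB.structure Definition CStarAlgebra (R : realType) :=
  {A of isCStarAlgebra R A & CompleteNormedModule R[i] A}.

Notation "x ** y" := (cmul x y) (at level 40, left associativity) : ring_scope.

Section CStarAlgebraDefs.
Context {R : realType} {A : cstarAlgType R}.
Implicit Types x y a b c : A.

(* The library norm of A takes its values in R[i]; they are nonnegative reals,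
   so taking the real part loses nothing. *)
Definition cnorm x : R := complex.Re `|x|.

Definition cpositive a : Prop := exists c, a = star c ** c.

(* The positive square root, unique for positive a; the value for other a is
   irrelevant. *)
Definition csqrt a : A := xget 0 [set b | cpositive b /\ b ** b = a]%classic.

(* x_1 ** ... ** x_n for n >= 1; there is no empty product without a unit,
   and the value 0 on the empty sequence is a dummy. *)
Definition cprod (s : seq A) : A :=
  if s is x :: s' then foldl cmul x s' else 0.

End CStarAlgebraDefs.

Section Blocks.
Context {r : nat}.
Implicit Types (B : {set 'I_r}) (i : 'I_r).

(* On a nonempty B the default value r is never attained. *)
Definition block_min B : nat := \big[minn/r]_(i in B) (i : nat).

Definition block_max B : nat := (\max_(i in B) (i : nat))%N.

Definition open_at B i : bool := (block_min B < i < block_max B)%N.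

End Blocks.

(* Positions are 'I_r and colours 'I_m (both starting at 0), a multi-index is a
   finite function 'I_k -> 'I_m, and the set T is ~: S. *)
Section OpenFamilies.
Context {R : realType} {A : cstarAlgType R} {r k m : nat}.
Variables (S : {set 'I_r}) (B : 'I_k -> {set 'I_r}) (l : 'I_r -> 'I_k).
Variable X : 'I_r -> {ffun 'I_k -> 'I_m} -> A.

Definition is_open : Prop :=
  forall i, i \notin S -> forall j j' : {ffun 'I_k -> 'I_m},
    (forall b : 'I_k, open_at (B b) i -> j b = j' b) -> X i j = X i j'.

(* For i in S, X i is constant on the multi-indices whose coordinate l i is j;
   the constant multi-index j is one of them. *)
Definition Xcol (i : 'I_r) (j : 'I_m) : A := X i [ffun=> j].

Definition Q (i : 'I_r) : R :=
  if i \notin S then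
    \big[Num.max/0]_(j : {ffun 'I_k -> 'I_m}) cnorm (X i j)
  else if #|B (l i)| == 1%N then
    Num.sqrt (cnorm (\sum_(j < m) csqrt (Xcol i j ** star (Xcol i j)))) *
    Num.sqrt (cnorm (\sum_(j < m) csqrt (star (Xcol i j) ** Xcol i j)))
  else if (i : nat) == block_min (B (l i)) then
    Num.sqrt (cnorm (\sum_(j < m) Xcol i j ** star (Xcol i j)))
  else (* i is the largest element of a two-element block *)
    Num.sqrt (cnorm (\sum_(j < m) star (Xcol i j) ** Xcol i j)).

End OpenFamilies.

(* Main.v *)
(** The product is read from right to left as a family of elements of the
    C*-algebra indexed by the colours of the blocks which are open at the
    current position. The column norm |sum_c v_c^* v_c|^(1/2) of this family is
    multiplied by at most Q_i at step i: opening a block (its largest element)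
    and passing an element of T are immediate from the order on positive
    elements, closing it (its smallest element) is the Cauchy-Schwarz inequality
    for Hilbert modules, and a singleton block contributes a constant factor
    sum_j x_j, bounded through the positivity of the 2 x 2 matrices with rows
    (|x^*|, x) and (x^*, |x|).

    The order structure is obtained without spectral theory or representations,
    in the algebra of bounded adjointable operators on A: square roots come from
    a monotone iteration, the bound |s| <= sqrt K for commuting self-adjoint
    s, u with s^2 + u^2 = K from the normal element s + i u, and the
    positivity of x^* x from Kaplansky's argument. *)

Require Import Defs.
From HB Require Import structures.
From mathcomp Require Import all_boot all_order all_algebra.
From mathcomp Require Import complex.
From mathcomp Require Import boolp classical_sets reals topology normedtype.
From mathcomp Require Import sequences ssrAC ring lra.

Set Implicit Arguments.
Unset Strict Implicit.
Unset Printing Implicit Defensive.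

Import Order.TTheory GRing.Theory Num.Theory.
Import numFieldNormedType.Exports.

Local Open Scope ring_scope.

(** * The real-valued norm, elementary identities and completeness *)

Lemma conj_realC (R : realType) (a : R) : Num.conj a%:C%C = a%:C%C.
Proof. exact: conjc_real. Qed.

Lemma conj_iC (R : realType) : Num.conj 'i%C = - 'i%C :> R[i].
Proof. by apply/eqP; rewrite eq_complex /= oppr0 !eqxx. Qed.

Section CNorm.
Context {R : realType} {A : cstarAlgType R}.
Implicit Types (x y z : A) (a : R).

Lemma normE x : `|x| = (cnorm x)%:C%C.
Proof.
have : 0 <= `|x| by [].
by rewrite /cnorm; case: `|x| => a b; rewrite lecE /= => /andP[/eqP->].
Qed.

Lemma cnorm_ge0 x : 0 <= cnorm x.
Proof. by rewrite -lecR -normE normr_ge0. Qed.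

Lemma cnorm0 : cnorm (0 : A) = 0.
Proof. by rewrite /cnorm normr0. Qed.

Lemma cnorm0_eq0 x : cnorm x = 0 -> x = 0.
Proof. by move=> x0; apply/normr0_eq0; rewrite normE x0. Qed.

Lemma cnormD x y : cnorm (x + y) <= cnorm x + cnorm y.
Proof. by rewrite -lecR rmorphD /= -!normE ler_normD. Qed.

Lemma cnormN x : cnorm (- x) = cnorm x.
Proof. by rewrite /cnorm normrN. Qed.

Lemma cnormB x y : cnorm (x - y) <= cnorm x + cnorm y.
Proof. by rewrite -(cnormN y) cnormD. Qed.

Lemma cdistC x y : cnorm (x - y) = cnorm (y - x).
Proof. by rewrite -cnormN opprB. Qed.

Lemma cnormZ a x : cnorm (a%:C%C *: x) = `|a| * cnorm x.
Proof.
apply: (@complexI R); rewrite rmorphM /= -!normE normrZ.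
by rewrite normc_def /= expr0n addr0 sqrtr_sqr.
Qed.

Lemma cnormZi x : cnorm ('i%C *: x) = cnorm x.
Proof.
apply: (@complexI R); rewrite -!normE normrZ.
by rewrite normc_def /= expr0n expr1n add0r sqrtr1 mul1r.
Qed.

Lemma cnormM x y : cnorm (x ** y) <= cnorm x * cnorm y.
Proof. by rewrite -lecR rmorphM /= -!normE norm_cmul. Qed.

Lemma cnorm_starM x : cnorm (star x ** x) = cnorm x ^+ 2.
Proof. by apply: (@complexI R); rewrite rmorphXn /= -!normE norm_starM. Qed.

Lemma cmul0x x : 0 ** x = 0.
Proof. by apply: (addrI (0 ** x)); rewrite -cmulDl !addr0. Qed.

Lemma cmulx0 x : x ** 0 = 0.
Proof. by apply: (addrI (x ** 0)); rewrite -cmulDr !addr0. Qed.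

Lemma cmulNl x y : (- x) ** y = - (x ** y).
Proof. by apply: (addrI (x ** y)); rewrite -cmulDl !subrr cmul0x. Qed.

Lemma cmulNr x y : x ** (- y) = - (x ** y).
Proof. by apply: (addrI (x ** y)); rewrite -cmulDr !subrr cmulx0. Qed.

Lemma star0 : star (0 : A) = 0.
Proof. by apply: (addrI (star 0)); rewrite -starD !addr0. Qed.

Lemma starN x : star (- x) = - star x.
Proof. by apply: (addrI (star x)); rewrite -starD !subrr star0. Qed.

(** The C*-identity gives |x|^2 = |x^* x| <= |x^*| |x|, and |x| cancels when it is nonzero. *)
Lemma cnorm_star_le x : cnorm x <= cnorm (star x).
Proof.
have [->|x_neq0] := eqVneq (cnorm x) 0; first exact: cnorm_ge0.
have x_gt0 : 0 < cnorm x by rewrite lt0r x_neq0 cnorm_ge0.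
by rewrite -(ler_pM2r x_gt0) -expr2 -cnorm_starM cnormM.
Qed.

Lemma cnorm_star x : cnorm (star x) = cnorm x.
Proof.
apply: le_anti; rewrite cnorm_star_le andbT.
by rewrite -[X in _ <= cnorm X]starK cnorm_star_le.
Qed.

(** Taking z = x - y, the C*-identity gives |x - y|^2 = 0. This nondegeneracy plays the role of a
    unit: identities between elements or multipliers are proved after multiplication by [star z]. *)
Lemma star_cmul_inj x y : (forall z, star z ** x = star z ** y) -> x = y.
Proof.
move=> eq_xy; apply/eqP; rewrite -subr_eq0; apply/eqP/cnorm0_eq0.
apply/eqP; rewrite -[_ == 0](@expf_eq0 _ _ 2) -cnorm_starM cmulDr cmulNr.
by rewrite eq_xy subrr cnorm0.
Qed.

(** Translates completeness from filters and [R[i]]-valued radii into sequences and real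
    tolerances. *)
Lemma cnorm_complete (u : nat -> A) :
    (forall e, 0 < e -> exists N, forall p q, (N <= p)%N -> (N <= q)%N ->
       cnorm (u p - u q) <= e) ->
  exists v, forall e, 0 < e -> exists N, forall p, (N <= p)%N ->
    cnorm (u p - v) <= e.
Proof.
move=> u_cauchy.
have e_re (e : R[i]) : 0 < e -> e = (complex.Re e)%:C%C /\ 0 < complex.Re e.
  move=> e0; have er : e = (complex.Re e)%:C%C.
    by rewrite RRe_real // ger0_real // ltW.
  by split => //; rewrite er ltcR in e0.
have : (cvg (u @ \oo))%classic.
  apply: cauchy_cvg; apply: cauchy_exP => e /e_re[-> e0].
  have [N uN] := u_cauchy _ (divr_gt0 e0 (ltr0n _ 2)).
  exists (u N); exists N => // p /= Np.
  rewrite -ball_normE /ball_ /= normE ltcR.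
  by apply: le_lt_trans (uN N p (leqnn N) Np) _; lra.
move=> /cvgrPdist_le u_cvg; exists (lim (u @ \oo))%classic => e e0.
have [|N _ uN] := u_cvg e%:C%C; first by rewrite ltcR.
by exists N => p Np; rewrite cdistC -lecR -normE; apply: uN.
Qed.

End CNorm.

(* The bounded adjointable operators on A, i.e. the multiplier algebra: a
   unital C*-algebra in which A sits by left multiplication. *)
Record mult (R : realType) (A : cstarAlgType R) := Mult {
  mfun :> A -> A;
  madj : A -> A;
  madjP : forall x y, star (mfun x) ** y = star x ** madj y;
  mbound : exists K, 0 <= K /\ forall x, cnorm (mfun x) <= K * cnorm x }.

(** * Multipliers: adjoints, ring and module operations *)

Section MultBasics.
Context {R : realType} {A : cstarAlgType R}.
Implicit Types (T U : mult A) (x y z : A) (a : R).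

Lemma madjP' T x y : star (madj T x) ** y = star x ** T y.
Proof. by apply: (can_inj starK); rewrite !starM !starK madjP. Qed.

(** The adjoint is determined by the map, by nondegeneracy, and the two remaining fields are
    propositions. *)
Lemma mult_ext T U : T =1 U -> T = U.
Proof.
move=> eqTU.
have eqTU' : madj T =1 madj U.
  by move=> y; apply: star_cmul_inj => z; rewrite -!madjP eqTU.
case: T U eqTU eqTU' => [f f' fP fB] [g g' gP gB] /= /funext eqf /funext eqf'.
by case: _ / eqf in gP gB *; case: _ / eqf' in gP gB *; congr Mult;
  apply: Prop_irrelevance.
Qed.

(** Linearity is not a field of [mult]; it follows from the existence of an adjoint. *)
Lemma mfunD T x y : T (x + y) = T x + T y.
Proof.
by apply: star_cmul_inj => z; rewrite cmulDr -!madjP' cmulDr.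
Qed.

Lemma mfunZ T (a : R[i]) x : T (a *: x) = a *: T x.
Proof. by apply: star_cmul_inj => z; rewrite cmulZr -!madjP' cmulZr. Qed.

Lemma mfunM T x y : T (x ** y) = T x ** y.
Proof. by apply: star_cmul_inj => z; rewrite -madjP' !cmulA madjP'. Qed.

(** With y = [madj T x], |y|^2 = |x^* T y| <= K |x| |y|. *)
Lemma madj_bound T : exists K, 0 <= K /\ forall x, cnorm (madj T x) <= K * cnorm x.
Proof.
have [K [K0 TK]] := mbound T; exists K; split=> // x.
have [->|x_neq0] := eqVneq (cnorm (madj T x)) 0.
  by rewrite mulr_ge0 ?cnorm_ge0.
have x_gt0 : 0 < cnorm (madj T x) by rewrite lt0r x_neq0 cnorm_ge0.
rewrite -(ler_pM2r x_gt0) -expr2 -cnorm_starM madjP'.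
apply: le_trans (cnormM _ _) _; rewrite cnorm_star.
by rewrite [K * _]mulrC -mulrA ler_wpM2l ?cnorm_ge0.
Qed.

Definition adj T : mult A := Mult (madjP' T) (madj_bound T).

Fact mult_zero_adj x y : star (0 : A) ** y = star x ** 0.
Proof. by rewrite star0 cmul0x cmulx0. Qed.
Fact mult_zero_bound : exists K, 0 <= K /\ forall x : A, cnorm (0 : A) <= K * cnorm x.
Proof. by exists 0; split=> // x; rewrite mul0r cnorm0. Qed.
Definition mult_zero := Mult mult_zero_adj mult_zero_bound.

Fact mult_one_adj x y : star (x : A) ** y = star x ** y.
Proof. by []. Qed.
Fact mult_one_bound : exists K, 0 <= K /\ forall x : A, cnorm x <= K * cnorm x.
Proof. by exists 1; split=> // x; rewrite mul1r. Qed.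
Definition mult_one := Mult mult_one_adj mult_one_bound.

Fact mult_opp_adj T x y : star (- T x) ** y = star x ** (- madj T y).
Proof. by rewrite starN cmulNl cmulNr madjP. Qed.
Fact mult_opp_bound T : exists K, 0 <= K /\ forall x, cnorm (- T x) <= K * cnorm x.
Proof.
by have [K [K0 TK]] := mbound T; exists K; split=> // x; rewrite cnormN.
Qed.
Definition mult_opp T := Mult (mult_opp_adj T) (mult_opp_bound T).

Fact mult_add_adj T U x y : star (T x + U x) ** y = star x ** (madj T y + madj U y).
Proof. by rewrite starD cmulDl cmulDr !madjP. Qed.
Fact mult_add_bound T U :
  exists K, 0 <= K /\ forall x, cnorm (T x + U x) <= K * cnorm x.
Proof.
have [K [K0 TK]] := mbound T; have [L [L0 UL]] := mbound U.
exists (K + L); split=> [|x]; first exact: addr_ge0.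
by rewrite mulrDl (le_trans (cnormD _ _)) ?lerD.
Qed.
Definition mult_add T U := Mult (mult_add_adj T U) (mult_add_bound T U).

Fact mult_mul_adj T U x y : star (T (U x)) ** y = star x ** (madj U (madj T y)).
Proof. by rewrite !madjP. Qed.
Fact mult_mul_bound T U :
  exists K, 0 <= K /\ forall x, cnorm (T (U x)) <= K * cnorm x.
Proof.
have [K [K0 TK]] := mbound T; have [L [L0 UL]] := mbound U.
exists (K * L); split=> [|x]; first exact: mulr_ge0.
by apply: le_trans (TK _) _; rewrite -mulrA ler_wpM2l.
Qed.
Definition mult_mul T U := Mult (mult_mul_adj T U) (mult_mul_bound T U).

Fact mult_scale_adj a T x y :
  star (a%:C%C *: T x) ** y = star x ** (a%:C%C *: madj T y).
Proof. by rewrite starZ conj_realC cmulZl cmulZr madjP. Qed.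
Fact mult_scale_bound a T :
  exists K, 0 <= K /\ forall x, cnorm (a%:C%C *: T x) <= K * cnorm x.
Proof.
have [K [K0 TK]] := mbound T.
exists (`|a| * K); split=> [|x]; first by rewrite mulr_ge0.
by rewrite cnormZ -mulrA ler_wpM2l.
Qed.
Definition mult_scale a T := Mult (mult_scale_adj a T) (mult_scale_bound a T).

Fact mult_i_adj x y : star ('i%C *: x : A) ** y = star x ** (- ('i%C *: y)).
Proof.
by rewrite starZ cmulZl conj_iC -scaleNr cmulZr.
Qed.
Fact mult_i_bound : exists K, 0 <= K /\ forall x : A, cnorm ('i%C *: x) <= K * cnorm x.
Proof. by exists 1; split=> // x; rewrite cnormZi mul1r. Qed.
Definition mult_i := Mult mult_i_adj mult_i_bound.

Fact mult_lmul_adj z x y : star (z ** x) ** y = star x ** (star z ** y).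
Proof. by rewrite starM cmulA. Qed.
Fact mult_lmul_bound z :
  exists K, 0 <= K /\ forall x, cnorm (z ** x) <= K * cnorm x.
Proof. by exists (cnorm z); split=> [|x]; rewrite ?cnorm_ge0 ?cnormM. Qed.
Definition lmul z := Mult (mult_lmul_adj z) (mult_lmul_bound z).

End MultBasics.

Section MultRing.
Variables (R : realType) (A : cstarAlgType R).

HB.instance Definition _ := gen_eqMixin (mult A).
HB.instance Definition _ := gen_choiceMixin (mult A).

Fact mult_addA : associative (@mult_add R A).
Proof. by move=> T U V; apply: mult_ext => x /=; rewrite addrA. Qed.
Fact mult_addC : commutative (@mult_add R A).
Proof. by move=> T U; apply: mult_ext => x /=; rewrite addrC. Qed.
Fact mult_add0 : left_id (@mult_zero R A) (@mult_add R A).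
Proof. by move=> T; apply: mult_ext => x /=; rewrite add0r. Qed.
Fact mult_addN : left_inverse (@mult_zero R A) (@mult_opp R A) (@mult_add R A).
Proof. by move=> T; apply: mult_ext => x /=; rewrite addNr. Qed.
HB.instance Definition _ :=
  GRing.isZmodule.Build (mult A) mult_addA mult_addC mult_add0 mult_addN.

Fact mult_mulA : associative (@mult_mul R A).
Proof. by move=> T U V; apply: mult_ext. Qed.
Fact mult_mul1l : left_id (@mult_one R A) (@mult_mul R A).
Proof. by move=> T; apply: mult_ext. Qed.
Fact mult_mul1r : right_id (@mult_one R A) (@mult_mul R A).
Proof. by move=> T; apply: mult_ext. Qed.
Fact mult_mulDl : left_distributive (@mult_mul R A) +%R.
Proof. by move=> T U V; apply: mult_ext. Qed.
Fact mult_mulDr : right_distributive (@mult_mul R A) +%R.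
Proof. by move=> T U V; apply: mult_ext => x /=; rewrite mfunD. Qed.
HB.instance Definition _ := GRing.Zmodule_isPzRing.Build (mult A)
  mult_mulA mult_mul1l mult_mul1r mult_mulDl mult_mulDr.

Fact mult_scaleA a b (T : mult A) :
  mult_scale a (mult_scale b T) = mult_scale (a * b) T.
Proof. by apply: mult_ext => x /=; rewrite scalerA rmorphM. Qed.
Fact mult_scale1 : left_id 1 (@mult_scale R A).
Proof. by move=> T; apply: mult_ext => x /=; rewrite scale1r. Qed.
Fact mult_scaleDr : right_distributive (@mult_scale R A) +%R.
Proof. by move=> a T U; apply: mult_ext => x /=; rewrite scalerDr. Qed.
Fact mult_scaleDl (T : mult A) : {morph (@mult_scale R A)^~ T : a b / a + b}.
Proof. by move=> a b; apply: mult_ext => x /=; rewrite rmorphD scalerDl. Qed.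
HB.instance Definition _ := GRing.Zmodule_isLmodule.Build R (mult A)
  mult_scaleA mult_scale1 mult_scaleDr mult_scaleDl.

End MultRing.

(** * Operator calculus, norm bounds and limits of multipliers *)

Section MultTheory.
Context {R : realType} {A : cstarAlgType R}.
Implicit Types (T U V : mult A) (x y z : A) (a : R).

Lemma maddE T U x : (T + U) x = T x + U x. Proof. by []. Qed.
Lemma moppE T x : (- T) x = - T x. Proof. by []. Qed.
Lemma mmulE T U x : (T * U) x = T (U x). Proof. by []. Qed.
Lemma mscaleE a T x : (a *: T) x = a%:C%C *: T x. Proof. by []. Qed.
Lemma mzeroE x : (0 : mult A) x = 0. Proof. by []. Qed.

Lemma mscaleAl a T U : a *: T * U = a *: (T * U).
Proof. exact: mult_ext. Qed.
Lemma mscaleAr a T U : T * (a *: U) = a *: (T * U).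
Proof. by apply: mult_ext => x; rewrite mmulE !mscaleE mfunZ. Qed.

Lemma adjK T : adj (adj T) = T. Proof. exact: mult_ext. Qed.
Lemma adj0 : adj (0 : mult A) = 0. Proof. exact: mult_ext. Qed.
Lemma adj1 : adj (1 : mult A) = 1. Proof. exact: mult_ext. Qed.
Lemma adjD T U : adj (T + U) = adj T + adj U. Proof. exact: mult_ext. Qed.
Lemma adjN T : adj (- T) = - adj T. Proof. exact: mult_ext. Qed.
Lemma adjB T U : adj (T - U) = adj T - adj U. Proof. exact: mult_ext. Qed.
Lemma adjM T U : adj (T * U) = adj U * adj T. Proof. exact: mult_ext. Qed.
Lemma adjZ a T : adj (a *: T) = a *: adj T. Proof. exact: mult_ext. Qed.
Lemma adj_sum (I : Type) (s : seq I) (P : pred I) (F : I -> mult A) :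
  adj (\sum_(i <- s | P i) F i) = \sum_(i <- s | P i) adj (F i).
Proof. exact: (big_morph adj adjD adj0). Qed.

(** [mult A] is a module over [R] only, so the imaginary unit enters as a central multiplier. *)
Definition mi : mult A := mult_i.
Lemma mi_comm T : mi * T = T * mi.
Proof. by apply: mult_ext => x; rewrite !mmulE /= mfunZ. Qed.
Lemma adj_mi : adj mi = - mi. Proof. exact: mult_ext. Qed.
Lemma mi_sqr : mi * mi = -1.
Proof.
apply: mult_ext => x; rewrite mmulE moppE /= scalerA -scaleN1r.
congr (_ *: _); apply/eqP.
by rewrite eq_complex /= !(mul0r, mul1r, mulr0) sub0r addr0 oppr0 !eqxx.
Qed.

Lemma lmulD x y : lmul (x + y) = lmul x + lmul y.
Proof. by apply: mult_ext => z /=; rewrite cmulDl. Qed.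
Lemma lmul0 : lmul (0 : A) = 0.
Proof. by apply: mult_ext => z /=; rewrite cmul0x. Qed.
Lemma lmulN x : lmul (- x) = - lmul x.
Proof. by apply: mult_ext => z /=; rewrite cmulNl. Qed.
Lemma lmulB x y : lmul (x - y) = lmul x - lmul y.
Proof. by rewrite lmulD lmulN. Qed.
Lemma lmulM x y : lmul (x ** y) = lmul x * lmul y.
Proof. by apply: mult_ext => z; rewrite mmulE /= cmulA. Qed.
Lemma lmul_star x : lmul (star x) = adj (lmul x).
Proof. exact: mult_ext. Qed.
Lemma mul_lmul T x : T * lmul x = lmul (T x).
Proof. by apply: mult_ext => z; rewrite mmulE /= mfunM. Qed.
Lemma lmul_sum (I : Type) (s : seq I) (P : pred I) (F : I -> A) :
  lmul (\sum_(i <- s | P i) F i) = \sum_(i <- s | P i) lmul (F i).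
Proof. exact: (big_morph _ lmulD lmul0). Qed.

(** Operator norm at most [K], stated as a relation so that no supremum is formed. *)
Definition bd (K : R) T := forall x, cnorm (T x) <= K * cnorm x.

Lemma bd_exists T : exists2 K, 0 < K & bd K T.
Proof.
have [K [K0 TK]] := mbound T; exists (K + 1) => [|x]; first exact: ltr_wpDl.
by apply: le_trans (TK x) _; rewrite ler_wpM2r ?cnorm_ge0 ?lerDl.
Qed.

Lemma bdW K L T : K <= L -> bd K T -> bd L T.
Proof. by move=> KL TK x; apply: le_trans (TK x) _; rewrite ler_wpM2r ?cnorm_ge0. Qed.

Lemma bdD K L T U : bd K T -> bd L U -> bd (K + L) (T + U).
Proof.
by move=> TK UL x; rewrite maddE mulrDl (le_trans (cnormD _ _)) ?lerD.
Qed.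

Lemma bdN K T : bd K T -> bd K (- T).
Proof. by move=> TK x; rewrite moppE cnormN. Qed.

Lemma bdB K L T U : bd K T -> bd L U -> bd (K + L) (T - U).
Proof. by move=> TK UL; apply/bdD/bdN. Qed.

Lemma bdM K L T U : 0 <= K -> bd K T -> bd L U -> bd (K * L) (T * U).
Proof.
by move=> K0 TK UL x; rewrite mmulE -mulrA (le_trans (TK _)) ?ler_wpM2l.
Qed.

Lemma bdZ a K T : bd K T -> bd (`|a| * K) (a *: T).
Proof. by move=> TK x; rewrite mscaleE cnormZ -mulrA ler_wpM2l. Qed.

Lemma bd0 : bd 0 0.
Proof. by move=> x; rewrite mzeroE cnorm0 mul0r. Qed.

Lemma bd1 : bd 1 1.
Proof. by move=> x; rewrite mul1r. Qed.

Lemma bd_small T : (forall e, 0 < e -> bd e T) -> T = 0.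
Proof.
move=> Te; apply: mult_ext => x; apply: cnorm0_eq0; apply: le_anti.
rewrite cnorm_ge0 andbT; apply/ler_addgt0Pr => e e0; rewrite add0r.
have x1 : 0 < cnorm x + 1 by rewrite ltr_wpDl ?cnorm_ge0.
apply: le_trans (Te _ (divr_gt0 e0 x1) x) _.
by rewrite mulrAC ler_pdivrMr // ler_wpM2l ?lerDl // ltW.
Qed.

(** The C*-identity for operators, from |T x|^2 = |x^* y| with y = [adj T (T x)]. *)
Lemma bd_sqr K T : 0 <= K -> bd (K ^+ 2) (adj T * T) -> bd K T.
Proof.
move=> K0 TK x; have Kx : 0 <= K * cnorm x by rewrite mulr_ge0 ?cnorm_ge0.
rewrite -ler_sqr ?nnegrE ?cnorm_ge0 // -cnorm_starM madjP.
apply: le_trans (cnormM _ _) _; rewrite cnorm_star exprMn [cnorm x ^+ 2]expr2.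
by rewrite mulrCA ler_wpM2l ?cnorm_ge0 //; apply: TK.
Qed.

Lemma bd_adj K T : 0 <= K -> bd K T -> bd K (adj T).
Proof.
move=> K0 TK x; have [->|x_neq0] := eqVneq (cnorm (adj T x)) 0.
  by rewrite mulr_ge0 ?cnorm_ge0.
have x_gt0 : 0 < cnorm (adj T x) by rewrite lt0r x_neq0 cnorm_ge0.
rewrite -(ler_pM2r x_gt0) -expr2 -cnorm_starM madjP.
apply: le_trans (cnormM _ _) _; rewrite cnorm_star.
by rewrite [K * _]mulrC -mulrA ler_wpM2l ?cnorm_ge0 //; apply: TK.
Qed.

(** The implication from left to right tests [lmul x] at [star x]; thus [lmul] is isometric. *)
Lemma bd_lmul K x : 0 <= K -> bd K (lmul x) <-> cnorm x <= K.
Proof.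
move=> K0; split=> [xK|xK y]; last first.
  by rewrite (le_trans (cnormM _ _)) // ler_wpM2r ?cnorm_ge0.
have := xK (star x); rewrite /= -[X in cnorm (X ** _)]starK cnorm_starM cnorm_star.
have [-> //|x_neq0] := eqVneq (cnorm x) 0.
by rewrite expr2 ler_pM2r // lt0r x_neq0 cnorm_ge0.
Qed.

Lemma lmul_inj : injective (@lmul R A).
Proof.
move=> x y eq_xy; apply/eqP; rewrite -subr_eq0; apply/eqP/cnorm0_eq0.
apply: le_anti; rewrite cnorm_ge0 andbT; apply/bd_lmul => //.
by rewrite lmulB eq_xy subrr; apply: bd0.
Qed.

(** The limit is taken pointwise and [d] is an explicit rate. Since the terms are self-adjoint, the
    limit serves as its own adjoint. *)
Lemma mult_complete (T_ : nat -> mult A) (d : nat -> R) :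
    (forall n, adj (T_ n) = T_ n) ->
    (forall p q, (p <= q)%N -> bd (d p) (T_ q - T_ p)) ->
    (forall e, 0 < e -> exists N, forall n, (N <= n)%N -> d n <= e) ->
  exists T, adj T = T /\ forall n, bd (d n) (T - T_ n).
Proof.
move=> T_adj T_d d0.
have d_cauchy e : 0 < e -> exists N, forall p q, (N <= p)%N -> (N <= q)%N ->
    bd e (T_ p - T_ q).
  move=> e0; have [N dN] := d0 _ e0; exists N => p q Np Nq.
  case/orP: (leq_total p q) => pq; last exact/(bdW (dN _ Nq))/T_d.
  by rewrite -opprB; apply/bdN/(bdW (dN _ Np))/T_d.
have lim_ex x : exists v, forall e, 0 < e -> exists N, forall p, (N <= p)%N ->
    cnorm (T_ p x - v) <= e.
  apply: cnorm_complete => e e0.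
  have x1 : 0 < cnorm x + 1 by rewrite ltr_wpDl ?cnorm_ge0.
  have [N TN] := d_cauchy _ (divr_gt0 e0 x1); exists N => p q Np Nq.
  apply: le_trans (TN p q Np Nq x) _.
  by rewrite mulrAC ler_pdivrMr // ler_wpM2l ?lerDl // ltW.
have [t tP] := choice lim_ex.
have t_d n x : cnorm (t x - T_ n x) <= d n * cnorm x.
  apply/ler_addgt0Pr => e e0; have [N tN] := tP x e e0.
  rewrite -[t x](subrK (T_ (maxn n N) x)) -addrA addrC.
  apply: le_trans (cnormD _ _) (lerD _ _); first exact/T_d/leq_maxl.
  by rewrite cdistC tN ?leq_maxr.
(* Replacing t by [T_ N] on either side costs at most [d N] |x| |y|. *)
have t_adj x y : star (t x) ** y = star x ** t y.
  apply/eqP; rewrite -subr_eq0; apply/eqP/cnorm0_eq0/le_anti.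
  rewrite cnorm_ge0 andbT; apply/ler_addgt0Pr => e e0; rewrite add0r.
  have xy1 : 0 < 2 * (cnorm x * cnorm y + 1).
    by rewrite mulr_gt0 // ltr_wpDl // mulr_ge0 ?cnorm_ge0.
  have [N dN] := d0 _ (divr_gt0 e0 xy1).
  have -> : star (t x) ** y - star x ** t y =
      star (t x - T_ N x) ** y - star x ** (t y - T_ N y).
    rewrite starD starN cmulDl cmulNl cmulDr cmulNr madjP.
    have -> : madj (T_ N) y = T_ N y by rewrite -[in RHS]T_adj.
    by rewrite opprD opprK addrACA addNr addr0.
  apply: le_trans (cnormB _ _) _.
  have le1 : cnorm (star (t x - T_ N x) ** y) <= d N * (cnorm x * cnorm y).
    apply: le_trans (cnormM _ _) _; rewrite cnorm_star mulrA.
    by rewrite ler_wpM2r ?cnorm_ge0.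
  have le2 : cnorm (star x ** (t y - T_ N y)) <= d N * (cnorm x * cnorm y).
    apply: le_trans (cnormM _ _) _; rewrite cnorm_star mulrCA.
    by rewrite ler_wpM2l ?cnorm_ge0.
  apply: le_trans (lerD le1 le2) _; rewrite -mulr2n -mulr_natl mulrCA.
  have xy0 : 0 <= cnorm x * cnorm y by rewrite mulr_ge0 ?cnorm_ge0.
  have := dN N (leqnn N); rewrite ler_pdivlMr // => dNe.
  (* The rate [d] carries no sign hypothesis, so a negative [d N] is treated separately. *)
  have [dN0|dN0] := leP 0 (d N).
    by apply: le_trans dNe; rewrite ler_wpM2l // ler_wpM2l // lerDl.
  apply: le_trans (ltW e0); rewrite nmulr_rle0 //; exact: mulr_ge0.
have t_bound : exists K, 0 <= K /\ forall x, cnorm (t x) <= K * cnorm x.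
  have [K K0 TK] := bd_exists (T_ 0%N); exists (`|d 0%N| + K).
  split=> [|x]; first by rewrite addr_ge0 // ltW.
  rewrite -[t x](subrK (T_ 0%N x)) mulrDl.
  apply: le_trans (cnormD _ _) (lerD _ (TK x)).
  by apply: le_trans (t_d _ _) _; rewrite ler_wpM2r ?cnorm_ge0 ?ler_norm.
by exists (Mult t_adj t_bound); split=> [|n x]; [exact: mult_ext | exact: t_d].
Qed.

End MultTheory.

(** * The positive cone: square roots, order and norm *)

Section PositiveCone.
Context {R : realType} {A : cstarAlgType R}.
Implicit Types (s t u w x y p q h g : mult A) (a K e : R).
Local Notation "a %:S" := (a *: (1 : mult A)) (at level 1, left associativity, format "a %:S").

Lemma mulBD_comm x y : x * y = y * x -> (x - y) * (x + y) = x * x - y * y.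
Proof. by move=> xy; rewrite mulrBl !mulrDr xy opprD addrA addrK. Qed.

Lemma mulDB_comm x y : x * y = y * x -> (x + y) * (x - y) = x * x - y * y.
Proof. by move=> xy; rewrite mulrDl !mulrBr xy addrA subrK. Qed.

Lemma scale_half x : 2^-1 *: (x + x) = x.
Proof.
rewrite scalerDr -scalerDl; have -> : 2^-1 + 2^-1 = 1 :> R by field.
by rewrite scale1r.
Qed.

Lemma bdC K : 0 <= K -> bd K (K%:S).
Proof. by move=> K0; have := bdZ K (@bd1 R A); rewrite ger0_norm ?mulr1. Qed.

Lemma adjC a : adj (a%:S) = a%:S.
Proof. by rewrite adjZ adj1. Qed.

Lemma mulCl a x : a%:S * x = a *: x.
Proof. by rewrite mscaleAl mul1r. Qed.

Lemma mulCr a x : x * a%:S = a *: x.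
Proof. by rewrite mscaleAr mulr1. Qed.

Lemma adjM_eq0 x : adj x * x = 0 -> x = 0.
Proof.
move=> x0; apply: bd_small => e e0; apply: (@bdW _ _ 0); first exact: ltW.
by apply: bd_sqr => //; rewrite expr0n x0; apply: bd0.
Qed.

Fixpoint majorant (n : nat) : R :=
  if n is n'.+1 then (1 + majorant n' ^+ 2) / 2 else 0.

Lemma majorant_bounds n : 0 <= majorant n <= 1.
Proof.
elim: n => [|n /andP[IH0 IH1]] /=; first by rewrite lexx ler01.
by apply/andP; split; nra.
Qed.

Lemma majorantS n : majorant n <= majorant n.+1.
Proof. by rewrite /=; have := sqr_ge0 (majorant n - 1); nra. Qed.

(** For v = 1 - [majorant n] the recursion reads v' = v - v^2 / 2, which forces decay of order 2 /
    n. *)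
Lemma majorant_rate n : (1 - majorant n) * (1 + n%:R / 2) <= 1.
Proof.
elim: n => [|n IH]; first by rewrite /= subr0 mul0r addr0 mulr1.
have /andP[m0 m1] := majorant_bounds n; rewrite /= -[n.+1%:R]natr1.
set m := majorant n in IH m0 m1 *; set k : R := n%:R / 2 in IH *.
have k0 : 0 <= k by rewrite divr_ge0.
have -> : 1 + (n%:R + 1) / 2 = 1 + k + 2^-1 :> R by rewrite /k; field.
have -> : 1 - (1 + m ^+ 2) / 2 = (1 - m) - (1 - m) ^+ 2 / 2 by field.
set v := 1 - m in IH *; have v0 : 0 <= v by rewrite /v subr_ge0.
have v1 : v <= 1 by rewrite /v; lra.
have : (v * (1 + k)) * (1 - v / 2) <= 1 * (1 - v / 2) by rewrite ler_wpM2r //; lra.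
nra.
Qed.

Lemma majorant_cvg e : 0 < e -> exists N, forall n, (N <= n)%N -> 1 - majorant n <= e.
Proof.
move=> e0; exists (Num.bound (2 / e)) => n Nn.
have ltn : 2 / e < n%:R.
  apply: lt_le_trans (archi_boundP _) _; first by rewrite divr_ge0 ?ltW.
  by rewrite ler_nat.
have k0 : 0 < 1 + n%:R / 2 :> R by rewrite ltr_pwDl // divr_ge0.
have := majorant_rate n; rewrite -ler_pdivlMr // => /le_trans; apply.
rewrite ler_pdivrMr // mulrDr mulr1.
have : e * (2 / e) < e * n%:R by rewrite ltr_pM2l.
rewrite mulrCA divff ?gt_eqF // mulr1; lra.
Qed.

(* The square root of 1 - g is 1 - t, where t is the limit of the iteration
   t' = (g + t^2) / 2; the same iteration started with g = 1 in R majorizes the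
   increments, so that no power series is needed. *)
Lemma sqrt_one_sub g : adj g = g -> bd 1 g ->
  exists t, [/\ adj t = t, bd 1 t, t + t = g + t * t
    & forall u, u * g = g * u -> u * t = t * u].
Proof.
move=> g_adj g1; pose T := fix T n : mult A := if n is n'.+1
  then 2^-1 *: (g + T n' * T n') else 0.
have T0 : T 0%N = 0 by [].
have TS n : T n.+1 = 2^-1 *: (g + T n * T n) by [].
move: T T0 TS => T T0 TS.
have T_adj n : adj (T n) = T n.
  by elim: n => [|n IH]; rewrite ?T0 ?adj0 // TS adjZ adjD adjM g_adj IH.
have T_comm u n : u * g = g * u -> u * T n = T n * u.
  move=> ug; elim: n => [|n IH]; first by rewrite T0 mulr0 mul0r.
  by rewrite TS mscaleAr mscaleAl mulrDr mulrDl ug mulrA IH -!mulrA IH.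
have T_commT (p q : nat) : T p * T q = T q * T p.
  exact: (T_comm (T p) q (esym (T_comm g p erefl))).
have half : `|2^-1 : R| = 2^-1 by rewrite ger0_norm ?invr_ge0.
have T_bd n : bd (majorant n) (T n).
  elim: n => [|n IH]; first by rewrite T0; apply: bd0.
  have /andP[m0 _] := majorant_bounds n.
  have := bdZ 2^-1 (bdD g1 (bdM m0 IH IH)); rewrite -TS; apply: bdW.
  by rewrite half [leRHS]/= expr2 mulrC.
have T_step n : bd (majorant n.+1 - majorant n) (T n.+1 - T n).
  elim: n => [|n IH].
    have := bdZ 2^-1 g1; rewrite half mulr1 TS T0 mulr0 addr0 !subr0.
    by apply: bdW; rewrite /= expr0n addr0 mul1r.
  (* The iterates commute, so a difference of squares factors; the increments of [majorant] obey the
     same recursion in R. *)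
  have -> : T n.+2 - T n.+1 = 2^-1 *: ((T n.+1 - T n) * (T n.+1 + T n)).
    rewrite mulBD_comm; last exact: T_commT.
    rewrite [T n.+2]TS.
    have -> : T n.+1 * T n.+1 - T n * T n = (g + T n.+1 * T n.+1) - (g + T n * T n).
      by rewrite opprD addrACA subrr add0r.
    by rewrite scalerBr -(TS n).
  have m0 : 0 <= majorant n.+1 - majorant n by rewrite subr_ge0 majorantS.
  have := bdZ 2^-1 (bdM m0 IH (bdD (T_bd n.+1) (T_bd n))); apply: bdW.
  rewrite half [majorant n.+2]/= -/(majorant n.+1).
  have : majorant n.+1 = (1 + majorant n ^+ 2) / 2 by [].
  by move: (majorant n.+1) (majorant n) => a b ->; nra.
have T_incr (p q : nat) : (p <= q)%N -> bd (majorant q - majorant p) (T q - T p).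
  elim: q => [|q IH]; first by rewrite leqn0 => /eqP->; rewrite !subrr; apply: bd0.
  rewrite leq_eqVlt => /predU1P[->|/IH pq]; first by rewrite !subrr; apply: bd0.
  by have := bdD (T_step q) pq; rewrite !addrA !subrK.
have [||t [t_adj t_bd]] := @mult_complete _ _ T (fun n => 1 - majorant n) T_adj.
- move=> p q /T_incr; apply: bdW; rewrite lerB //.
  by have /andP[] := majorant_bounds q.
- exact: majorant_cvg.
have t1 : bd 1 t by have := t_bd 0%N; rewrite T0 /= !subr0.
exists t; split=> // [|u ug]; apply/eqP; rewrite -subr_eq0; apply/eqP/bd_small => e e0.
  (* Four error terms result, each at most e / 4. *)
  have [N mN] := majorant_cvg (divr_gt0 e0 (ltr0n _ 4)).
  have -> : t + t - (g + t * t) = (t - T N.+1) + (t - T N.+1)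
      - (t * (t - T N) + (t - T N) * T N).
    have -> : (t - T N.+1) + (t - T N.+1) = t + t - (g + T N * T N).
      rewrite addrACA -opprD; congr (_ - _).
      by rewrite TS -scalerDr scale_half.
    rewrite mulrBr mulrBl addrA subrK !opprD opprK.
    by rewrite -!addrA [- (T N * T N) + _]addrCA addNr addr0.
  have dN := mN N (leqnn N); have dS := mN N.+1 (leqnSn N).
  have /andP[m0 m1] := majorant_bounds N.
  have d0 : 0 <= 1 - majorant N by rewrite subr_ge0.
  apply: bdW (bdB (bdD (t_bd _) (t_bd _)) (bdD (bdM ler01 t1 (t_bd N))
    (bdM d0 (t_bd N) (T_bd N)))).
  by nra.
have [K K0 uK] := bd_exists u.
have [N mN] := majorant_cvg (divr_gt0 e0 (mulr_gt0 (ltr0n _ 2) K0)).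
have -> : u * t - t * u = u * (t - T N) - (t - T N) * u.
  by rewrite mulrBr mulrBl (T_comm _ _ ug) opprB addrA subrK.
have d0 : 0 <= 1 - majorant N by rewrite subr_ge0; have /andP[] := majorant_bounds N.
apply: bdW (bdB (bdM (ltW K0) uK (t_bd N)) (bdM d0 (t_bd N) uK)).
have := mN N (leqnn N); rewrite ler_pdivlMr ?mulr_gt0 //; nra.
Qed.

(** Positivity is encoded by self-adjoint square roots rather than by the spectrum. Closure under
    sums and positivity of [adj x * x] then become theorems. *)
Definition psd p := exists2 s, adj s = s & p = s * s.

Lemma psd_adj p : psd p -> adj p = p.
Proof. by case=> s s_adj ->; rewrite adjM s_adj. Qed.

Lemma psd_sqr s : adj s = s -> psd (s * s).
Proof. by exists s. Qed.

Lemma psdZ a p : 0 <= a -> psd p -> psd (a *: p).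
Proof.
move=> a0 [s s_adj ->]; exists (Num.sqrt a *: s); first by rewrite adjZ s_adj.
by rewrite mscaleAl mscaleAr scalerA -(expr2 (Num.sqrt a)) sqr_sqrtr.
Qed.

Lemma psd1 : psd 1.
Proof. by exists 1; rewrite ?adj1 ?mulr1. Qed.

Lemma psd0 : psd 0.
Proof. by exists 0; rewrite ?adj0 ?mulr0. Qed.

Lemma psdC a : 0 <= a -> psd a%:S.
Proof. by move=> a0; apply/psdZ/psd1. Qed.

(* Unitary trick: s and u are the real and imaginary parts of s + i u, and
   |s + i u|^2 = K. *)
Lemma bd_sum_sqr s u K : 0 <= K -> adj s = s -> adj u = u -> s * u = u * s ->
  s * s + u * u = K%:S -> bd (Num.sqrt K) s.
Proof.
move=> K0 s_adj u_adj su eqK; set v := mi * u.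
have v_adj : adj v = - v by rewrite adjM adj_mi u_adj mulrN -mi_comm.
have sv : s * v = v * s by rewrite /v mulrA -mi_comm -mulrA su mulrA.
have vv : s * s - v * v = K%:S.
  rewrite /v -mulrA [u * _]mulrA -mi_comm -mulrA mulrA mi_sqr mulN1r opprK.
  exact: eqK.
have z1 : bd (Num.sqrt K) (s + v).
  apply: bd_sqr; rewrite ?sqrtr_ge0 // sqr_sqrtr // adjD s_adj v_adj.
  by rewrite mulBD_comm // vv; apply: bdC.
have z2 : bd (Num.sqrt K) (s - v).
  apply: bd_sqr; rewrite ?sqrtr_ge0 // sqr_sqrtr // adjB s_adj v_adj opprK.
  by rewrite mulDB_comm // vv; apply: bdC.
have -> : s = 2^-1 *: ((s + v) + (s - v)).
  by rewrite addrACA subrr addr0 scale_half.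
apply: bdW (bdZ _ (bdD z1 z2)).
by rewrite ger0_norm ?invr_ge0 //; lra.
Qed.

(** A rescaling of [sqrt_one_sub]. The bound on sqrt K - u is what later shows that the root is
    itself positive. *)
Lemma sqrt_subC K h : 0 <= K -> adj h = h -> bd K h ->
  exists u, [/\ adj u = u, u * u = K%:S - h, bd (Num.sqrt K) ((Num.sqrt K)%:S - u)
    & forall x, x * h = h * x -> x * u = u * x].
Proof.
(* K = 0 forces h = 0; it is separated because the main case divides by K. *)
rewrite le_eqVlt => /predU1P[<- _ h0|K0 h_adj hK].
  have -> : h = 0 by apply: bd_small => e e0; apply/bdW/h0/ltW.
  exists 0; split=> [|||x _]; rewrite ?adj0 ?scale0r ?mulr0 ?mul0r ?subr0 //.
  by rewrite sqrtr0 scale0r; apply: bd0.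
have [||t [t_adj t1 tt t_comm]] := @sqrt_one_sub (K^-1 *: h).
- by rewrite adjZ h_adj.
- have := bdZ K^-1 hK; rewrite ger0_norm ?invr_ge0 ?ltW //.
  by rewrite mulVf ?gt_eqF.
exists (Num.sqrt K *: (1 - t)); split=> [|||x xh].
- by rewrite adjZ adjB adj1 t_adj.
- rewrite mscaleAl mscaleAr scalerA -(expr2 (Num.sqrt K)) sqr_sqrtr ?ltW //.
  rewrite mulrBr mulr1 mulrBl mul1r opprB.
  have -> : 1 - t + (t * t - t) = 1 - K^-1 *: h.
    have -> : K^-1 *: h = t + t - t * t by rewrite tt addrK.
    by rewrite opprB opprD -addrA [- t + _]addrCA.
  by rewrite scalerBr scalerA mulfV ?gt_eqF // scale1r.
- rewrite -scalerBr subKr.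
  by have := bdZ (Num.sqrt K) t1; rewrite ger0_norm ?sqrtr_ge0 ?mulr1.
- rewrite mscaleAr mscaleAl mulrBr mulrBl mulr1 mul1r t_comm //.
  by rewrite mscaleAr mscaleAl xh.
Qed.

Lemma psd_subC K h : 0 <= K -> adj h = h -> bd K h -> psd (K%:S - h).
Proof. by move=> K0 h_adj /(sqrt_subC K0 h_adj)[u [u_adj <- _ _]]; exists u. Qed.

(** Write h = K - (K - h). Together with [bd_of_psd] this describes the cone by norm inequalities,
    which are stable under sums and limits. *)
Lemma psd_of_bd K h : 0 <= K -> adj h = h -> bd K (K%:S - h) -> psd h.
Proof.
move=> K0 h_adj /psd_subC; rewrite adjB adjC h_adj subKr.
by apply.
Qed.

(** If p = s^2 and K - p = u^2, then s^2 + u^2 = K, and [bd_sum_sqr] bounds u by sqrt K. *)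
Lemma bd_of_psd K p : 0 <= K -> psd p -> bd K p -> bd K (K%:S - p).
Proof.
move=> K0 p_psd pK; have [s s_adj p_eq] := p_psd.
have [u [u_adj uu _ u_comm]] := sqrt_subC K0 (psd_adj p_psd) pK.
have us : u * s = s * u by apply/esym/u_comm; rewrite p_eq mulrA.
have uK : bd (Num.sqrt K) u.
  by apply: (bd_sum_sqr (u := s)) => //; rewrite uu p_eq subrK.
by have := bdM (sqrtr_ge0 _) uK uK; rewrite uu -expr2 sqr_sqrtr.
Qed.

(** [sqrt_subC] is applied to K - p, of norm at most K; the root lies within sqrt K of sqrt K, hence
    is positive. *)
Lemma sqrt_psd p : psd p ->
  exists s, [/\ psd s, s * s = p & forall x, x * p = p * x -> x * s = s * x].
Proof.
move=> p_psd; have [K K0 pK] := bd_exists p.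
have K_ge0 := ltW K0; have p_adj := psd_adj p_psd.
have [|s [s_adj ss s_bd s_comm]] := sqrt_subC K_ge0 _ (bd_of_psd K_ge0 p_psd pK).
  by rewrite adjB adjC p_adj.
exists s; split=> [||x xp].
- exact: psd_of_bd (sqrtr_ge0 _) s_adj s_bd.
- by rewrite ss subKr.
- by apply: s_comm; rewrite mulrBr mulrBl mulCr mulCl xp.
Qed.

Lemma psdD p q : psd p -> psd q -> psd (p + q).
Proof.
move=> p_psd q_psd; have [K K0 pK] := bd_exists p; have [L L0 qL] := bd_exists q.
have [K_ge0 L_ge0] := (ltW K0, ltW L0).
apply: (@psd_of_bd (K + L)); first exact: addr_ge0.
  by rewrite adjD !psd_adj.
rewrite scalerDl opprD addrACA.
exact/bdD/bd_of_psd/qL/q_psd/L_ge0/bd_of_psd.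
Qed.

Lemma psd_sum (I : Type) (r : seq I) (P : pred I) (F : I -> mult A) :
  (forall i, P i -> psd (F i)) -> psd (\sum_(i <- r | P i) F i).
Proof. by move=> F_psd; elim/big_ind: _ => //; [exact: psd0 | exact: psdD]. Qed.

(** The positive roots of p and q commute with each other, so their product is a self-adjoint root
    of p q. *)
Lemma psdM_comm p q : psd p -> psd q -> p * q = q * p -> psd (p * q).
Proof.
move=> /sqrt_psd[s [s_psd <- s_comm]] /sqrt_psd[u [u_psd <- u_comm]] pq.
have us : u * s = s * u by apply: s_comm; apply/esym/u_comm.
exists (s * u); first by rewrite adjM !psd_adj.
by rewrite -!mulrA [u * (s * u)]mulrA us !mulrA.
Qed.

(** The roots of p and K - p commute and their squares add up to K, so [bd_sum_sqr] applies. *)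
Lemma bd_of_psdC K p : 0 <= K -> psd p -> psd (K%:S - p) -> bd K p.
Proof.
move=> K0 /sqrt_psd[s [s_psd <- s_comm]] /sqrt_psd[u [u_psd uu u_comm]].
have su : s * u = u * s.
  by apply: u_comm; rewrite mulrBr mulrBl mulCr mulCl mulrA.
have sK : bd (Num.sqrt K) s.
  by apply: (bd_sum_sqr (u := u)) => //; rewrite ?psd_adj // uu addrC subrK.
by have := bdM (sqrtr_ge0 _) sK sK; rewrite -expr2 sqr_sqrtr.
Qed.

Lemma psd_antisym p : psd p -> psd (- p) -> p = 0.
Proof.
move=> p_psd pN_psd; apply: bd_small => e e0; apply: (bdW (ltW e0)).
by apply: bd_of_psdC; rewrite ?scale0r ?sub0r.
Qed.

(** The norm description of the cone passes to the limit e -> 0. This removes the regularizing e in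
    the inequalities below. *)
Lemma psd_closed h k : adj h = h -> adj k = k ->
  (forall e, 0 < e -> psd (h + e *: k)) -> psd h.
Proof.
move=> h_adj k_adj hk; have [K K0 hK] := bd_exists h; have [L L0 kL] := bd_exists k.
have KL : 0 <= K + L by rewrite addr_ge0 ?ltW.
apply: (psd_of_bd KL) => // x; apply/ler_addgt0Pr => d d0.
(* The first condition keeps h + e k bounded by K + L, the second makes the error e k x at most
   d. *)
have [e e0 [e1 ed]] : exists2 e, 0 < e & e <= 1 /\ e * (L * cnorm x) <= d.
  have Lx : 0 < L * cnorm x + 1 by rewrite ltr_wpDl // mulr_ge0 ?cnorm_ge0 ?ltW.
  exists (Num.min 1 (d / (L * cnorm x + 1))); first by rewrite lt_min ltr01 divr_gt0.
  split; first by rewrite ge_min lexx.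
  apply: (@le_trans _ _ (d / (L * cnorm x + 1) * (L * cnorm x))).
    apply: ler_wpM2r; first by rewrite mulr_ge0 ?cnorm_ge0 ?ltW.
    by rewrite ge_min lexx orbT.
  by rewrite mulrAC ler_pdivrMr // ler_wpM2l ?lerDl // ltW.
have eL : bd (e * L) (e *: k) by have := bdZ e kL; rewrite gtr0_norm.
have heK : bd (K + L) (h + e *: k).
  by apply: bdW (bdD hK eL); rewrite lerD2l ler_piMl // ltW.
have := bd_of_psd KL (hk e e0) heK.
move=> /bdD/(_ eL)/(_ x); rewrite opprD addrA subrK => /le_trans; apply.
by rewrite mulrDl lerD2l -mulrA.
Qed.

Lemma psd_exp p n : psd p -> psd (p ^+ n).
Proof.
move=> p_psd; elim: n => [|n IH]; first by rewrite expr0; apply: psd1.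
by rewrite exprS; apply: psdM_comm => //; rewrite -exprS exprSr.
Qed.

(* With p = y (adj y), (1 - p)^n y = y (1 + w^2)^n stays bounded, hence so does
   n w^4. *)
Lemma adjM_neg_contraction y w : bd 1 y -> adj w = w -> adj y * y = - (w * w) ->
  psd (y * adj y) -> y = 0.
Proof.
move=> y1 w_adj yy p_psd; set p := y * adj y in p_psd.
have y1' : bd 1 (adj y) by apply: bd_adj.
have p1 : bd 1 (1 - p).
  have := bdM ler01 y1 y1'; rewrite mulr1 => /(bd_of_psd ler01 p_psd).
  by rewrite scale1r.
set u := 1 + w * w.
have ww_psd : psd (w * w) by apply: psd_sqr.
have u_psd : psd u by apply: psdD => //; apply: psd1.
have uw : w * w * u = u * (w * w) by rewrite /u mulrDr mulrDl mulr1 mul1r.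
have uwn n : w * w * u ^+ n = u ^+ n * (w * w).
  elim: n => [|n IH]; first by rewrite expr0 mulr1 mul1r.
  by rewrite exprS mulrA uw -!mulrA -IH !mulrA.
have yu n : y * u ^+ n = (1 - p) ^+ n * y.
  elim: n => [|n IH]; first by rewrite !expr0 mulr1 mul1r.
  rewrite exprSr mulrA IH exprSr -!mulrA; congr (_ * _).
  by rewrite /u /p mulrDr mulrBl mulr1 mul1r -[_ * _ * y]mulrA yy mulrN opprK.
have bd_un n : bd 1 (w * w * u ^+ n).
  have pn1 : bd 1 ((1 - p) ^+ n).
    elim: n => [|n IH]; first by rewrite expr0; apply: bd1.
    by have := bdM ler01 p1 IH; rewrite mulr1 -exprS.
  have := bdN (bdM ler01 y1' (bdM ler01 pn1 y1)).
  by rewrite !mulr1 -yu mulrA yy mulNr opprK.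
have un_psd n : psd (u ^+ n) by apply: psd_exp.
have un1 n : psd (u ^+ n - 1).
  elim: n => [|n IH]; first by rewrite expr0 subrr; apply: psd0.
  rewrite exprSr /u mulrDr mulr1 -/u addrAC; apply: psdD => //.
  by rewrite -uwn; apply: psdM_comm.
(* Bernoulli's inequality: u^n >= 1 makes w^2 u^n grow by at least w^4 at each step. *)
have grow n : psd (w * w * u ^+ n - n%:R *: (w * w * (w * w))).
  elim: n => [|n IH]; first by rewrite expr0 mulr1 scale0r subr0.
  rewrite exprSr {2}/u mulrDr mulr1 mulrDr -[n.+1%:R]natr1 scalerDl scale1r opprD.
  rewrite addrACA; apply: psdD => //.
  rewrite -uwn -mulrBr -[X in _ - X]mulr1 -mulrBr.
  have c : w * w * (u ^+ n - 1) = (u ^+ n - 1) * (w * w).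
    by rewrite mulrBr mulrBl mulr1 mul1r uwn.
  by apply: psdM_comm; [| apply: psdM_comm |rewrite -[RHS]mulrA -c].
have w4 : w * w * (w * w) = 0.
  (* Here 0 <= n w^4 <= w^2 u^n <= 1, and n exceeds 1 / e. *)
  apply: bd_small => e e0; pose n := (Num.bound e^-1).+1.
  have n0 : 0 < n%:R :> R by rewrite ltr0n.
  have : bd 1 (n%:R *: (w * w * (w * w))).
    apply: bd_of_psdC => //; first by apply: psdZ; rewrite ?ler0n //; apply: psdM_comm.
    rewrite -[_ - _](subrKA (w * w * u ^+ n)); apply: psdD => //.
    apply: psd_subC => //; rewrite psd_adj //; apply: psdM_comm => //.
  move=> /(bdZ n%:R^-1); rewrite scalerA mulVf ?gt_eqF // scale1r; apply: bdW.
  rewrite mulr1 gtr0_norm ?invr_gt0 // -[e]invrK lef_pV2 ?posrE ?invr_gt0 //.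
  apply: ltW; apply: lt_le_trans (archi_boundP _) _; first by rewrite invr_ge0 ltW.
  by rewrite ler_nat.
have w2 : w * w = 0 by apply: adjM_eq0; rewrite (psd_adj ww_psd).
by apply: adjM_eq0; rewrite yy w2 oppr0.
Qed.

Lemma adjM_neg y w : adj w = w -> adj y * y = - (w * w) -> psd (y * adj y) -> y = 0.
Proof.
move=> w_adj yy p_psd; have [K K0 yK] := bd_exists y.
have KV : 0 <= K^-1 by rewrite invr_ge0 ltW.
suff : K^-1 *: y = 0.
  by move/(congr1 ( *:%R K)); rewrite scalerA mulfV ?gt_eqF // scale1r scaler0.
apply: (@adjM_neg_contraction _ (K^-1 *: w)).
- by have := bdZ K^-1 yK; rewrite ger0_norm ?mulVf ?gt_eqF.
- by rewrite adjZ w_adj.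
- by rewrite adjZ !mscaleAl !mscaleAr yy !scalerN.
- by rewrite adjZ mscaleAl mscaleAr scalerA; apply: psdZ => //; apply: mulr_ge0.
Qed.

(* Kaplansky's argument: with h = (adj x) x and n = |h| - h, the element y = x n
   satisfies (adj y) y <= 0, while y (adj y) + (adj y) y is a sum of squares. *)
Lemma psd_adjM x : psd (adj x * x).
Proof.
set h := adj x * x; have h_adj : adj h = h by rewrite adjM adjK.
have [k [k_psd kk k_comm]] := sqrt_psd (psd_sqr h_adj).
have hk : h * k = k * h by apply: k_comm; rewrite mulrA.
have [r [r_psd rr r_comm]] := sqrt_psd k_psd.
have [k_adj r_adj] := (psd_adj k_psd, psd_adj r_psd).
have hr : h * r = r * h by apply: r_comm.
have kr : k * r = r * k by rewrite -rr mulrA.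
set n := k - h; have n_adj : adj n = n by rewrite adjB k_adj h_adj.
(* From h^2 = k^2; n is twice the negative part of h. *)
have hn : h * n = - (k * n) by rewrite /n !mulrBr opprB hk kk.
have rn : r * n = n * r by rewrite mulrBr mulrBl kr hr.
have rn_adj : adj (r * n) = r * n by rewrite adjM r_adj n_adj rn.
set y := x * n.
have yy : adj y * y = - (r * n * (r * n)).
  rewrite /y adjM n_adj -mulrA [adj x * _]mulrA -/h hn mulrN -rr; congr (- _).
  by rewrite {1}rn !mulrA.
have y0 : y = 0.
  apply: (adjM_neg rn_adj yy).
  have -> : y * adj y = 2^-1 *: ((y + adj y) * (y + adj y) +
      (mi * (y - adj y)) * (mi * (y - adj y))) + r * n * (r * n).
    rewrite -[r * n * _]opprK -yy; apply/(canRL (addrK _)).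
    have -> : (mi * (y - adj y)) * (mi * (y - adj y)) = - ((y - adj y) * (y - adj y)).
      by rewrite -mulrA [(y - _) * (mi * _)]mulrA -mi_comm -mulrA mulrA mi_sqr mulN1r.
    rewrite !(mulrDl, mulrDr) mulrNN !mulNr !mulrN.
    set a := y * y; set b := adj y * adj y; set c := adj y * y; set d := y * adj y.
    rewrite !opprD !opprK.
    rewrite [a + d]addrC [- a + d]addrC [d + a + _]addrACA [d - a + _]addrACA.
    have -> : d + c + (a + b) + (d + c + (- a - b)) = d + c + (d + c).
      by rewrite -opprD addrACA subrr addr0.
    by rewrite scale_half.
  apply: psdD; last exact: psd_sqr.
  apply: psdZ; first by rewrite invr_ge0.
  apply: psdD; apply: psd_sqr; first by rewrite adjD adjK addrC.
  by rewrite adjM adj_mi adjB adjK mulrN -mi_comm -mulrN opprB.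
(* As x n = 0, also h n = 0 and k n = - h n = 0, so n^2 = k n - h n = 0. Then h = k is positive. *)
have nhn : n * n = 0.
  have hn0 : h * n = 0 by rewrite /h -mulrA -/y y0 mulr0.
  by rewrite {1}/n mulrBl hn0 subr0; apply/oppr_inj; rewrite -hn hn0 oppr0.
have /eqP : n = 0 by apply: adjM_eq0; rewrite n_adj.
by rewrite subr_eq0 => /eqP <-.
Qed.

Lemma psd_conj p y : psd p -> psd (adj y * p * y).
Proof.
move=> [s s_adj ->]; rewrite mulrA -mulrA -[X in X * _]/(adj y * s).
by rewrite -{1}s_adj -adjM; apply: psd_adjM.
Qed.

End PositiveCone.

(** * Inverses, square roots inside A, polar positivity and Cauchy-Schwarz *)

Section SquareRootsAndPolarForm.
Context {R : realType} {A : cstarAlgType R}.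
Implicit Types (s t u v w x y p q h g c d : mult A) (a K e : R).
Local Notation "a %:S" := (a *: (1 : mult A)) (at level 1, left associativity, format "a %:S").

(** The partial sums of the geometric series in Horner form converge at the rate of the real tail
    [K ^+ n / (1 - K)]. *)
Lemma neumann g K : 0 <= K -> K < 1 -> adj g = g -> bd K g ->
  exists v, [/\ adj v = v, (1 - g) * v = 1 & v * (1 - g) = 1].
Proof.
move=> K0 K1 g_adj gK; pose T := fix T n : mult A := if n is n'.+1
  then 1 + g * T n' else 0.
have T0 : T 0%N = 0 by [].
have TS n : T n.+1 = 1 + g * T n by [].
move: T T0 TS => T T0 TS.
have T_comm n : g * T n = T n * g.
  elim: n => [|n IH]; first by rewrite T0 mulr0 mul0r.
  by rewrite TS mulrDr mulrDl mulr1 mul1r {1}IH mulrA.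
have T_adj n : adj (T n) = T n.
  by elim: n => [|n IH]; rewrite ?T0 ?adj0 // TS adjD adj1 adjM g_adj IH T_comm.
have K1' : 0 < 1 - K by rewrite subr_gt0.
pose D n := K ^+ n / (1 - K).
have DS n : K ^+ n = D n - D n.+1.
  by rewrite /D exprS; field; rewrite gt_eqF.
have D_ge0 n : 0 <= D n by rewrite divr_ge0 ?exprn_ge0 // ltW.
have T_step n : bd (D n - D n.+1) (T n.+1 - T n).
  rewrite -DS; elim: n => [|n IH].
    by rewrite TS T0 mulr0 addr0 subr0 expr0; apply: bd1.
  rewrite exprS [T n.+2]TS {2}[T n.+1]TS opprD addrACA subrr add0r -mulrBr.
  exact: bdM.
have T_incr (k l : nat) : (k <= l)%N -> bd (D k - D l) (T l - T k).
  elim: l => [|l IH]; first by rewrite leqn0 => /eqP->; rewrite !subrr; apply: bd0.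
  rewrite leq_eqVlt => /predU1P[->|/IH kl]; first by rewrite !subrr; apply: bd0.
  by have := bdD kl (T_step l); rewrite subrKA [X in bd _ X]addrC subrKA.
have D_cvg e : 0 < e -> exists N, forall n, (N <= n)%N -> D n <= e.
  move=> e0; have e1 : 0 < e * (1 - K) by rewrite mulr_gt0.
  have /cvg_expr/cvgrPdist_le/(_ _ e1)[N _ NP] : `|K| < 1 by rewrite ger0_norm.
  exists N => n /NP; rewrite sub0r normrN ger0_norm ?exprn_ge0 // => Kn.
  by rewrite ler_pdivrMr.
have [||v [v_adj v_bd]] := @mult_complete _ _ T D T_adj.
- by move=> k l /T_incr; apply: bdW; rewrite gerBl.
- exact: D_cvg.
have gv : (1 - g) * v = 1.
  apply/eqP; rewrite -subr_eq0; apply/eqP/bd_small => e e0.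
  have [N DN] := D_cvg _ (divr_gt0 e0 (ltr0n _ 2)).
  have -> : (1 - g) * v - 1 = (v - T N.+1) - g * (v - T N).
    rewrite TS mulrBl mulrBr mul1r opprD opprB.
    by rewrite [RHS](AC (1*2*2) ((1*5*2)*(3*4))) /= addNr addr0.
  apply: bdW (bdB (v_bd _) (bdM K0 gK (v_bd N))).
  have := DN N (leqnn N); have := DN N.+1 (leqnSn N).
  have := D_ge0 N; have : K * D N <= 1 * D N by rewrite ler_wpM2r // ltW.
  lra.
by exists v; split=> //; have := congr1 (@adj R A) gv; rewrite adjM adjB adj1 g_adj v_adj.
Qed.

(** p + e is K + e times 1 - g, where g = (K - p) / (K + e) has norm at most K / (K + e) < 1. The
    inverse v is positive because v = v (p + e) v. *)
Lemma psd_inv p e : psd p -> 0 < e ->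
  exists v, [/\ psd v, (p + e%:S) * v = 1 & v * (p + e%:S) = 1].
Proof.
move=> p_psd e0; have [K K0 pK] := bd_exists p; have p_adj := psd_adj p_psd.
have Ke : 0 < K + e by rewrite addr_gt0.
set h := p + e%:S; have h_adj : adj h = h by rewrite adjD adjC p_adj.
have h_psd : psd h by apply/psdD/psdC/ltW.
have hE : 1 - (K + e)^-1 *: h = (K + e)^-1 *: (K%:S - p).
  rewrite -[X in X - _]scale1r -[1 in LHS](mulVf (lt0r_neq0 Ke)) -scalerA -scalerBr.
  by rewrite /h scalerDl [p + _]addrC addrKA.
have [||||v [v_adj hv vh]] := @neumann (1 - (K + e)^-1 *: h) ((K + e)^-1 * K).
- by rewrite mulr_ge0 ?invr_ge0 ?ltW.
- by rewrite mulrC ltr_pdivrMr // mul1r ltrDl.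
- by rewrite adjB adj1 adjZ h_adj.
- rewrite hE; have := bdZ (K + e)^-1 (bd_of_psd (ltW K0) p_psd pK).
  by rewrite ger0_norm ?invr_ge0 ?ltW.
rewrite subKr mscaleAl -mscaleAr in hv; rewrite subKr mscaleAr -mscaleAl in vh.
exists ((K + e)^-1 *: v); split=> //.
set v' := _ *: v in hv vh *; have v'_adj : adj v' = v' by rewrite adjZ v_adj.
by rewrite -[v']mulr1 -hv mulrA -{1}v'_adj; apply: psd_conj.
Qed.

Lemma inv_intertwine x h h' v v' : h * v = 1 -> v' * h' = 1 -> x * h = h' * x ->
  x * v = v' * x.
Proof.
by move=> hv vh xh; rewrite -[x in LHS]mul1r -vh -!mulrA [h' * _]mulrA -xh -mulrA hv mulr1.
Qed.

(* The left ideal lmul A is closed, and s is the norm limit of s (s^2 + e)^-1 s^2. *)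
Lemma sqrt_in_lmul s (z : A) : adj s = s -> s * s = lmul z -> exists b, s = lmul b.
Proof.
move=> s_adj sz.
have approx e : 0 < e -> exists b, bd e (s - lmul b).
  move=> e0; have e2 : 0 < e ^+ 2 by rewrite exprn_gt0.
  have [v [v_psd hv vh]] := psd_inv (psd_sqr s_adj) e2.
  have v_adj := psd_adj v_psd; set h := s * s + _ in hv vh.
  have sv : s * v = v * s.
    by apply: inv_intertwine hv vh _; rewrite mulrDr mulrDl mulCr mulCl mulrA.
  exists ((s * v) z); rewrite -mul_lmul -sz -mulrA.
  have -> : v * (s * s) = 1 - e ^+ 2 *: v.
    by rewrite -vh mulrDr mulCr addrK.
  rewrite mulrBr mulr1 subKr mscaleAr.
  apply: bd_sqr; first exact: ltW.
  rewrite adjZ adjM s_adj v_adj mscaleAl mscaleAr scalerA.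
  have -> : v * s * (s * v) = v * (s * s) * v by rewrite !mulrA.
  (* The square of s^2 - e^2 is positive; conjugated by v, the inverse of s^2 + e^2, it bounds 4 e^2
     v s^2 v by 1 and hence the error e^2 s v. *)
  have le1 : psd (1 - (4 * e ^+ 2) *: (v * (s * s) * v)).
    have -> : 1 - (4 * e ^+ 2) *: (v * (s * s) * v) =
        adj v * ((s * s - (e ^+ 2)%:S) * (s * s - (e ^+ 2)%:S)) * v.
      have -> : (s * s - (e ^+ 2)%:S) * (s * s - (e ^+ 2)%:S) =
          h * h - (4 * e ^+ 2) *: (s * s).
        rewrite /h; move: (s * s) (e ^+ 2) => P k.
        have -> : 4 * k = k + k + (k + k) by ring.
        rewrite !scalerDl !(mulrDl, mulrDr) !mulrN !mulNr opprK !mulCl !mulCr.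
        by rewrite !opprD [RHS](AC (2*2*(2*2)) (1*5*(6*4)*(2*7)*(3*8))) /= !subrr !addr0.
      rewrite v_adj mulrBr mulrBl mscaleAr mscaleAl; congr (_ - _).
      by rewrite mulrA vh mul1r hv.
    by apply/psd_conj/psd_sqr; rewrite adjB adjM s_adj adjC.
  apply: bd_of_psdC; first exact: exprn_ge0 (ltW e0).
    apply: psdZ; first by rewrite mulr_ge0 ?ltW.
    by rewrite -{1}v_adj; apply/psd_conj/psd_sqr.
  have -> : (e ^+ 2)%:S - (e ^+ 2 * e ^+ 2) *: (v * (s * s) * v) =
      (3 / 4 * e ^+ 2)%:S + (e ^+ 2 / 4) *: (1 - (4 * e ^+ 2) *: (v * (s * s) * v)).
    rewrite scalerBr scalerA addrA -scalerDl; congr (_%:S - _ *: _); by field.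
  apply: psdD; first by apply: psdC; rewrite mulr_ge0 ?divr_ge0 // ltW.
  by apply: psdZ => //; rewrite divr_ge0 // ltW.
have approxn (n : nat) : exists b, bd n.+1%:R^-1 (s - lmul b).
  by apply: approx; rewrite invr_gt0.
have [b bP] := choice approxn.
have inv_small e : 0 < e -> exists N, forall n, (N <= n)%N -> n.+1%:R^-1 <= e :> R.
  move=> e0; exists (Num.bound e^-1) => n Nn.
  rewrite -[e]invrK lef_pV2 ?posrE ?invr_gt0 //.
  apply: ltW; apply: lt_le_trans (archi_boundP _) _; first by rewrite invr_ge0 ltW.
  by rewrite ler_nat leqW.
(* Since [lmul] is isometric, the approximants form a Cauchy sequence in A. *)
have [e e0|z' z'P] := @cnorm_complete _ _ b.
  have [N NP] := inv_small _ (divr_gt0 e0 (ltr0n _ 2)); exists N => k l Nk Nl.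
  apply/bd_lmul; first exact: ltW.
  have -> : lmul (b k - b l) = (s - lmul (b l)) - (s - lmul (b k)).
    by rewrite lmulB opprB [RHS]addrC subrKA.
  by apply: bdW (bdB (bP l) (bP k)); rewrite [leRHS]splitr lerD ?NP.
exists z'; apply/eqP; rewrite -subr_eq0; apply/eqP/bd_small => e e0.
have e2 := divr_gt0 e0 (ltr0n _ 2).
have [N NP] := inv_small _ e2; have [M MP] := z'P _ e2.
pose n := maxn N M; rewrite -[s - _](subrKA (lmul (b n))) -lmulB.
have /bd_lmul := MP n (leq_maxr _ _) => /(_ (ltW e2)) /(bdD (bP n)).
by apply: bdW; rewrite [leRHS]splitr lerD2r NP ?leq_maxl.
Qed.

(** [csqrt] is chosen by [xget], so a candidate in A must be exhibited. Its positivity asks for a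
    further element of A, so a root is extracted twice and both roots are shown to come from A. *)
Lemma csqrt_spec (x : A) :
  psd (lmul (csqrt (star x ** x))) /\
  lmul (csqrt (star x ** x)) * lmul (csqrt (star x ** x)) = adj (lmul x) * lmul x.
Proof.
have xx : lmul (star x ** x) = adj (lmul x) * lmul x by rewrite lmulM lmul_star.
have [s [s_psd ss _]] := sqrt_psd (psd_adjM (lmul x)).
rewrite -xx in ss; have [b sb] := sqrt_in_lmul (psd_adj s_psd) ss.
have [r [r_psd rr _]] := sqrt_psd s_psd; rewrite [in RHS]sb in rr.
have [b' rb'] := sqrt_in_lmul (psd_adj r_psd) rr.
have b_ex : exists c : A, cpositive c /\ c ** c = star x ** x.
  exists b; split; last by apply: lmul_inj; rewrite lmulM -sb ss.
  exists b'; apply: lmul_inj; rewrite lmulM lmul_star -rb' (psd_adj r_psd).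
  by rewrite rr.
have [[f fE] cc] : cpositive (csqrt (star x ** x)) /\
    csqrt (star x ** x) ** csqrt (star x ** x) = star x ** x.
  exact: (@xgetPex A 0 [set b | cpositive b /\ b ** b = star x ** x]%classic).
by rewrite -lmulM cc xx {1}fE lmulM lmul_star; split=> //; apply: psd_adjM.
Qed.

(** The relation x |x| = |x^*| x. The defect z satisfies d z = - z c, so z^* z c is positive as a
    product of commuting positive operators, and negative as - z^* d z. It vanishes, and z with
    it. *)
Lemma sqrt_intertwine x c d : psd c -> psd d -> c * c = adj x * x ->
  d * d = x * adj x -> x * c = d * x.
Proof.
move=> c_psd d_psd cc dd; set z := x * c - d * x.
have [c_adj d_adj] := (psd_adj c_psd, psd_adj d_psd).
have dz : d * z = - (z * c).
  rewrite /z mulrBr mulrBl opprB !mulrA; congr (_ - _).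
  by rewrite dd -[x * c * c]mulrA cc mulrA.
have qc : adj z * z * c = - (adj z * d * z) by rewrite -!mulrA dz mulrN opprK.
have m_psd : psd (adj z * d * z) by apply: psd_conj.
have cq : c * (adj z * z) = adj z * z * c.
  apply: (can_inj adjK); rewrite [LHS]adjM [RHS]adjM !adjM !adjK c_adj.
  by apply: (can_inj adjK); rewrite qc adjN (psd_adj m_psd) -qc !adjM !adjK c_adj.
have qc0 : adj z * z * c = 0.
  apply: psd_antisym; last by rewrite qc opprK.
  by apply: psdM_comm => //; apply: psd_adjM.
have zc0 : z * c = 0.
  apply: adjM_eq0; rewrite adjM c_adj -mulrA [adj z * _]mulrA.
  by rewrite qc0 mulr0.
have q2 : adj z * z * (adj z * z) = 0.
  rewrite {2}/z mulrBr [adj z * (d * x)]mulrA.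
  have -> : adj z * d = 0 by rewrite -d_adj -adjM dz zc0 oppr0 adj0.
  rewrite mul0r subr0 -!mulrA [c * _]mulrA.
  have -> : c * adj z = 0 by rewrite -c_adj -adjM zc0 adj0.
  by rewrite mul0r !mulr0.
have z0 : z = 0.
  by apply/adjM_eq0/adjM_eq0; rewrite adjM adjK.
by apply/eqP; rewrite -subr_eq0 -/z z0.
Qed.

(* The 2 x 2 matrix with rows (d, x) and (x^*, c) is positive: complete the
   square with the regularized inverse of c. *)
Lemma psd_polar x c d u v : psd c -> psd d -> c * c = adj x * x ->
  d * d = x * adj x ->
  psd (adj u * d * u + adj v * c * v + (adj u * x * v + adj v * adj x * u)).
Proof.
move=> c_psd d_psd cc dd; have xc := sqrt_intertwine c_psd d_psd cc dd.
have [c_adj d_adj] := (psd_adj c_psd, psd_adj d_psd).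
apply: (@psd_closed _ _ _ (adj v * v)).
- rewrite !adjD !adjM !adjK c_adj d_adj !mulrA; congr (_ + _); exact: addrC.
- by rewrite adjM adjK.
move=> e e0; have [f [f_psd hf fh]] := psd_inv c_psd e0.
have [f' [f'_psd hf' fh']] := psd_inv d_psd e0.
have f_adj := psd_adj f_psd; set h := c + _ in hf fh; set h' := d + _ in hf' fh'.
have xf : x * f = f' * x.
  by apply: inv_intertwine hf fh' _; rewrite mulrDr mulrDl mulCr mulCl xc.
have df : d * f' = f' * d.
  by apply: inv_intertwine hf' fh' _; rewrite mulrDr mulrDl mulCr mulCl.
have xfx : x * f * adj x = d - e *: (f' * d).
  by rewrite xf -mulrA -dd mulrA -mscaleAl -[X in X - _]mul1r -mulrBl -fh' mulrDr mulCr addrK.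
have hE : h = c + e%:S by [].
have h_psd : psd h by apply/psdD/psdC/ltW.
move: h hE hf fh h_psd xf => h hE hf fh h_psd xf.
(* The completed square, with f the inverse of h = c + e. The remainder is positive because f' and d
   commute. *)
have -> : adj u * d * u + adj v * c * v + (adj u * x * v + adj v * adj x * u)
    + e *: (adj v * v)
  = adj (v + f * adj x * u) * h * (v + f * adj x * u)
    + e *: (adj u * (f' * d) * u).
  rewrite adjD !adjM adjK f_adj.
  have e1 : (adj v + adj u * (x * f)) * h * (v + f * adj x * u) =
     adj v * h * v + adj v * adj x * u + (adj u * x * v + adj u * (x * f * adj x) * u).
    rewrite !mulrDl !mulrDr.
    have -> : adj v * h * (f * adj x * u) = adj v * adj x * u.
      by rewrite -!mulrA [h * _]mulrA hf mul1r.
    have -> : adj u * (x * f) * h = adj u * x by rewrite -!mulrA fh mulr1.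
    by rewrite -!mulrA.
  rewrite e1 xfx mulrBr mulrBl mscaleAr mscaleAl hE mulrDr mulrDl mulCr mscaleAl.
  set a1 := adj u * d * u; set a2 := adj v * c * v; set a3 := adj u * x * v.
  set a4 := adj v * adj x * u; set a5 := e *: (adj v * v).
  set a6 := e *: (adj u * (f' * d) * u).
  rewrite -[RHS]addrA -[a3 + _ + _]addrA subrK.
  by rewrite [RHS](AC (3*2) (5*1*(4*3)*2)).
apply: psdD; first exact: psd_conj.
by apply/psdZ/psd_conj/psdM_comm => //; rewrite ?ltW.
Qed.

(** Write C, D for the sums of the c i, d i. Summing [psd_polar] at u = - k y, v = 1 with k = 1 / (K
    + e) gives 2 k y^* y <= k^2 y^* D y + C. Since D <= K + e and C <= L, y^* y <= (K + e) L; then e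
    -> 0. *)
Lemma sum_polar_le (I : finType) (x c d : I -> mult A) (K L : R) :
    0 <= K -> 0 <= L ->
    (forall i, psd (c i)) -> (forall i, psd (d i)) ->
    (forall i, c i * c i = adj (x i) * x i) ->
    (forall i, d i * d i = x i * adj (x i)) ->
    psd (K%:S - \sum_i d i) -> psd (L%:S - \sum_i c i) ->
  psd ((K * L)%:S - adj (\sum_i x i) * \sum_i x i).
Proof.
move=> K0 L0 c_psd d_psd cc dd dK cL; set y := \sum_i x i.
apply: (@psd_closed _ _ _ L%:S); rewrite ?adjC //.
  by rewrite adjB adjM adjK adjC.
move=> e e0; have Ke : 0 < K + e by rewrite ltr_wpDl.
pose k := (K + e)^-1; have k0 : 0 <= k by rewrite invr_ge0 ltW.
set D := \sum_i d i in dK; set C := \sum_i c i in cL.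
have : psd (adj (- k *: y) * D * (- k *: y) + adj 1 * C * 1
    + (adj (- k *: y) * y * 1 + adj 1 * adj y * (- k *: y))).
  rewrite /D /C; set z := - k *: y.
  rewrite !mulr_sumr !mulr_suml /y adj_sum !mulr_sumr !mulr_suml -!big_split /=.
  by apply: psd_sum => i _; apply: psd_polar.
rewrite adjZ adj1 !mul1r !mulr1 !mscaleAl !mscaleAr !scalerA mulrNN !scaleNr.
set E := adj y * y; set F := adj y * D * y => psd1.
have psd2 : psd ((k * k) *: (adj y * ((K + e)%:S - D) * y)).
  apply: psdZ; first exact: mulr_ge0.
  by apply: psd_conj; rewrite scalerDl addrAC; apply/psdD/psdC/ltW.
rewrite mulrBr mulrBl -/F mulCr mscaleAl -/E scalerBr scalerA in psd2.
have kK : k * k * (K + e) = k by rewrite -mulrA mulVf ?mulr1 // gt_eqF.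
rewrite kK in psd2; have := psdD (psdD psd1 psd2) cL.
have -> : (k * k) *: F + C + (- (k *: E) - k *: E) + (k *: E - (k * k) *: F) + (L%:S - C)
    = L%:S - k *: E.
  set G := k *: E; set H := _ *: F.
  by rewrite [LHS](AC (2*2*2*2) (7*3*(1*6)*(2*8)*(5*4))) /= !subrr !addr0.
move/(psdZ (ltW Ke)); rewrite scalerBr !scalerA mulfV ?gt_eqF // scale1r.
by rewrite mulrDl scalerDl addrAC.
Qed.

(** With k = K + e, expand the positive sum of the squares of k y_i - x_i^* z and use that the sum
    of the x_i x_i^* is at most k. Taking e > 0 makes k invertible. *)
Lemma cauchy_schwarz (I : finType) (x y : I -> mult A) (K : R) : 0 <= K ->
    psd (K%:S - \sum_i x i * adj (x i)) ->
  psd (K *: (\sum_i adj (y i) * y i) - adj (\sum_i x i * y i) * \sum_i x i * y i).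
Proof.
move=> K0 xK; set z := \sum_i x i * y i; set B := \sum_i adj (y i) * y i.
have B_adj : adj B = B.
  by rewrite /B adj_sum; apply: eq_bigr => i _; rewrite adjM adjK.
apply: (psd_closed _ B_adj) => [|e e0]; first by rewrite adjB adjZ adjM adjK B_adj.
have Ke : 0 < K + e by rewrite ltr_wpDl.
set k := K + e in Ke; set E := adj z * z; set D := \sum_i _ in xK.
have psd1 : psd (\sum_i adj (k *: y i - adj (x i) * z) * (k *: y i - adj (x i) * z)).
  by apply: psd_sum => i _; apply: psd_adjM.
have psd2 : psd (adj z * (k%:S - D) * z).
  by apply: psd_conj; rewrite scalerDl addrAC; apply/psdD/psdC/ltW.
rewrite mulrBr mulrBl mulCr mscaleAl -/E in psd2.
have sumE : \sum_i adj (k *: y i - adj (x i) * z) * (k *: y i - adj (x i) * z) =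
    (k * k) *: B - k *: E - k *: E + adj z * D * z.
  have -> : (k * k) *: B - k *: E - k *: E + adj z * D * z =
     \sum_i ((k * k) *: (adj (y i) * y i) - k *: (adj z * (x i * y i))
       - k *: (adj (x i * y i) * z) + adj z * (x i * adj (x i)) * z).
    rewrite !big_split /= !sumrN -!scaler_sumr -mulr_sumr -!mulr_suml -mulr_sumr.
    by rewrite -/z -/B -/D -adj_sum -/z.
  apply: eq_bigr => i _; rewrite adjB adjZ adjM adjK mulrBl !mulrBr.
  rewrite !mscaleAl !mscaleAr scalerA !adjM !mulrA opprB.
  by rewrite [LHS](AC (2*2) (1*4*2*3)).
rewrite sumE in psd1; have := psdD psd1 psd2.
have -> : (k * k) *: B - k *: E - k *: E + adj z * D * z + (k *: E - adj z * D * z)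
   = (k * k) *: B - k *: E.
  by rewrite addrA -[_ + _ + k *: E]addrA [adj z * D * z + _]addrC addrA addrK subrK.
have kV : 0 <= k^-1 by rewrite invr_ge0 ltW.
move/(psdZ kV); rewrite scalerBr !scalerA mulKf ?gt_eqF // mulVf ?gt_eqF // scale1r.
by rewrite /k scalerDl addrAC.
Qed.

End SquareRootsAndPolarForm.

(** * Changing one coordinate of a multi-index *)

Section Update.
Context {k m : nat}.
Implicit Types (j : {ffun 'I_k -> 'I_m}) (b : 'I_k) (c : 'I_m).

Definition upd j b c : {ffun 'I_k -> 'I_m} :=
  [ffun b' => if b' == b then c else j b'].

Lemma upd_same j b c : upd j b c b = c.
Proof. by rewrite ffunE eqxx. Qed.

Lemma upd_other j b c b' : b' != b -> upd j b c b' = j b'.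
Proof. by rewrite ffunE => /negPf->. Qed.

Lemma upd_idem j b c c' : upd (upd j b c) b c' = upd j b c'.
Proof. by apply/ffunP => b'; rewrite !ffunE; case: eqP. Qed.

Lemma upd_comm j b b' c c' : b' != b ->
  upd (upd j b c) b' c' = upd (upd j b' c') b c.
Proof.
move=> bb'; apply/ffunP => a; rewrite !ffunE.
by case: (eqVneq a b) => [->|//]; rewrite eq_sym (negPf bb').
Qed.

(** Exchanging c with the coordinate j b is an involution on pairs; after reindexing, c is free and
    contributes the factor m. *)
Lemma sum_upd (V : nmodType) (f : {ffun 'I_k -> 'I_m} -> V) b :
  \sum_j \sum_c f (upd j b c) = (\sum_j f j) *+ m.
Proof.
rewrite pair_big /=.
pose swap (p : {ffun 'I_k -> 'I_m} * 'I_m) := (upd p.1 b p.2, p.1 b).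
have swapK : involutive swap.
  move=> [j c]; rewrite /swap /= upd_same upd_idem; congr (_, _).
  by apply/ffunP => b'; rewrite ffunE; case: eqP => [->|].
rewrite -(reindex_inj (inv_inj swapK) (P := xpredT) (F := fun p => f p.1)) /=.
rewrite -(pair_big xpredT xpredT (fun j _ => f j)) /= -sumrMnl.
by apply: eq_bigr => j _; rewrite sumr_const card_ord.
Qed.

End Update.

(** * The right-to-left recursion and its bound *)

(* Reading the product from right to left, vrec keeps the partial sums over the
   indices of the blocks lying entirely to the right. Instead of restricting a
   family v to the indices of the blocks that are still open, all of its values
   over the whole index set are kept, and the multiplicity is accounted for by
   the factors wmin and wmax. *)
Section Recursion.
Context {R : realType} {A : cstarAlgType R} {r k m : nat}.
Variables (ismin ismax : pred 'I_r) (l : 'I_r -> 'I_k).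
Variable x : 'I_r -> {ffun 'I_k -> 'I_m} -> mult A.
Implicit Types (i : 'I_r) (j : {ffun 'I_k -> 'I_m}) (b : 'I_k) (c : 'I_m).
Implicit Types s : seq 'I_r.
Local Notation "a %:S" := (a *: (1 : mult A)) (at level 1, left associativity, format "a %:S").

Fixpoint vrec s j : mult A :=
  if s is i :: s' then
    if ismin i then \sum_c x i (upd j (l i) c) * vrec s' (upd j (l i) c)
    else x i j * vrec s' j
  else 1.

Definition wmin i : R := if ismin i then m%:R else 1.
Definition wmax i : R := if ismax i then m%:R^-1 else 1.

Hypothesis m_gt0 : (0 < m)%N.
Hypothesis indep_min : forall i i' j c, ismin i -> (i' < i)%N ->
  x i' (upd j (l i) c) = x i' j.
Hypothesis indep_max : forall i i' j c, ismax i -> (i < i')%N ->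
  x i' (upd j (l i) c) = x i' j.

Lemma vrec_indep b s : (forall i j c, i \in s -> x i (upd j b c) = x i j) ->
  forall j c, vrec s (upd j b c) = vrec s j.
Proof.
elim: s => [//|i s IH] xb j c /=.
have xs i' j' c' : i' \in s -> x i' (upd j' b c') = x i' j'.
  by move=> i's; apply: xb; rewrite in_cons i's orbT.
have xi j' c' : x i (upd j' b c') = x i j' by apply: xb; rewrite mem_head.
case: ifP => _; last by rewrite xi IH.
apply: eq_bigr => c' _; have [->|lb] := eqVneq (l i) b; first by rewrite upd_idem.
by rewrite upd_comm // xi IH.
Qed.

(** The letters move one by one from the left product into [vrec]. At a minimum the letters to its
    left ignore the colour of the block, so the sum over that colour passes to the right factor and
    each term is counted m times. *)
Lemma sum_prod_vrec s1 s2 : pairwise (fun i i' : 'I_r => (i < i')%N) (s1 ++ s2) ->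
  (\prod_(i <- s2) wmin i) *: (\sum_j \prod_(i <- s1 ++ s2) x i j)
    = \sum_j (\prod_(i <- s1) x i j) * vrec s2 j.
Proof.
elim: s2 s1 => [|i s2 IH] s1 s_lt.
  by rewrite big_nil scale1r cats0; apply: eq_bigr => j _; rewrite mulr1.
have := IH (rcons s1 i); rewrite cat_rcons => /(_ s_lt) {}IH.
rewrite big_cons -scalerA IH /=.
have -> : \sum_j (\prod_(i' <- rcons s1 i) x i' j) * vrec s2 j
    = \sum_j (\prod_(i' <- s1) x i' j) * (x i j * vrec s2 j).
  by apply: eq_bigr => j _; rewrite -cats1 big_cat big_seq1 mulrA.
rewrite /wmin; case: ifP => i_min; last by rewrite scale1r.
rewrite scaler_nat -(sum_upd _ (l i)); apply: eq_bigr => j _.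
rewrite mulr_sumr; apply: eq_bigr => c _; congr (_ * _).
rewrite [LHS]big_seq [RHS]big_seq; apply: eq_bigr => i' i's1.
apply: indep_min => //; move: s_lt; rewrite pairwise_cat => /andP[/allrelP s_lt _].
by apply: s_lt; rewrite // mem_head.
Qed.

Variable q : 'I_r -> R.
Hypothesis q_ge0 : forall i, 0 <= q i.
Hypothesis q_open : forall i j, ~~ ismin i -> ~~ ismax i ->
  psd ((q i)%:S - adj (x i j) * x i j).
Hypothesis q_max : forall i j, ~~ ismin i -> ismax i ->
  psd ((q i)%:S - \sum_c adj (x i (upd j (l i) c)) * x i (upd j (l i) c)).
Hypothesis q_min : forall i j, ismin i -> ~~ ismax i ->
  psd ((q i)%:S - \sum_c x i (upd j (l i) c) * adj (x i (upd j (l i) c))).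
Hypothesis q_single : forall i j, ismin i -> ismax i ->
  psd ((q i)%:S - adj (\sum_c x i (upd j (l i) c)) * \sum_c x i (upd j (l i) c)).

Definition sqnorm (v : {ffun 'I_k -> 'I_m} -> mult A) : mult A :=
  \sum_j adj (v j) * v j.

Lemma sqnorm_mul_le (y v : {ffun 'I_k -> 'I_m} -> mult A) K :
    (forall j, psd (K%:S - adj (y j) * y j)) ->
  psd (K *: sqnorm v - sqnorm (fun j => y j * v j)).
Proof.
move=> yK; rewrite /sqnorm scaler_sumr -sumrB; apply: psd_sum => j _.
have := psd_conj (v j) (yK j).
by rewrite mulrBr mulrBl mulCr mscaleAl adjM !mulrA.
Qed.

Lemma vrec_step i s : all (fun i' : 'I_r => (i < i')%N) s ->
  psd ((q i * wmin i * wmax i) *: sqnorm (vrec s) - sqnorm (vrec (i :: s))).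
Proof.
move=> /allP i_lt; have m0 : m%:R != 0 :> R by rewrite pnatr_eq0 -lt0n.
have indep : ismax i -> forall j c, vrec s (upd j (l i) c) = vrec s j.
  by move=> i_max; apply: vrec_indep => i' j c /i_lt; apply: indep_max.
rewrite /wmin /wmax; have [i_min|i_min] := boolP (ismin i);
    have [i_max|i_max] := boolP (ismax i).
(* Singleton: [vrec s] ignores the colour, so the sum over it factors out. *)
- rewrite mulfK //.
  have -> : sqnorm (vrec (i :: s)) =
      sqnorm (fun j => (\sum_c x i (upd j (l i) c)) * vrec s j).
    apply: eq_bigr => j _; rewrite /= i_min.
    have -> : \sum_c x i (upd j (l i) c) * vrec s (upd j (l i) c) =
        (\sum_c x i (upd j (l i) c)) * vrec s j.
      by rewrite mulr_suml; apply: eq_bigr => c _; rewrite indep.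
    by [].
  by apply: sqnorm_mul_le => j; apply: q_single.
(* Closing a block: Cauchy-Schwarz in the colour being summed, for each j. *)
- rewrite mulr1 -scalerA scaler_nat /sqnorm.
  rewrite -(sum_upd (fun j => adj (vrec s j) * vrec s j) (l i)) scaler_sumr -sumrB.
  apply: psd_sum => j _ /=; rewrite i_min.
  by apply: cauchy_schwarz => //; apply: q_min.
(* Opening a block: [vrec s] ignores the new colour, so the terms regroup into column sums, each
   counted m times. *)
- have -> : sqnorm (vrec (i :: s)) = m%:R^-1 *: \sum_j adj (vrec s j) *
      (\sum_c adj (x i (upd j (l i) c)) * x i (upd j (l i) c)) * vrec s j.
    apply: (@scalerI _ _ m%:R) => //; rewrite scalerA mulfV // scale1r scaler_nat.
    rewrite -(sum_upd _ (l i)); apply: eq_bigr => j _.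
    rewrite mulr_sumr mulr_suml; apply: eq_bigr => c _.
    by rewrite /= (negPf i_min) indep // adjM !mulrA.
  rewrite mulr1 mulrC -scalerA -scalerBr; apply: psdZ; first by rewrite invr_ge0.
  rewrite scaler_sumr -sumrB; apply: psd_sum => j _.
  have := psd_conj (vrec s j) (q_max j i_min i_max).
  by rewrite mulrBr mulrBl mulCr mscaleAl.
- rewrite !mulr1.
  have -> : sqnorm (vrec (i :: s)) = sqnorm (fun j => x i j * vrec s j).
    by apply: eq_bigr => j _; rewrite /= (negPf i_min).
  by apply: sqnorm_mul_le => j; apply: q_open.
Qed.

(** The induction starts from the constant family 1, whose square norm over all multi-indices is
    m^k. *)
Lemma sqnorm_vrec_le s : pairwise (fun i i' : 'I_r => (i < i')%N) s ->
  psd (((\prod_(i <- s) (q i * wmin i * wmax i)) * m%:R ^+ k)%:S - sqnorm (vrec s)).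
Proof.
elim: s => [_|i s IH /=].
  rewrite big_nil mul1r /sqnorm /=.
  under eq_bigr do rewrite adj1 mulr1.
  rewrite sumr_const card_ffun !card_ord -[X in _ - X]scaler_nat natrX subrr; exact: psd0.
move=> /andP[i_lt /IH s_le]; rewrite big_cons.
have w0 : 0 <= q i * wmin i * wmax i.
  by rewrite !mulr_ge0 /wmin /wmax //; case: ifP => _; rewrite ?invr_ge0.
have := psdD (psdZ w0 s_le) (vrec_step i_lt).
by rewrite scalerBr scalerA subrKA mulrA.
Qed.

Hypothesis prod_wmin : \prod_i wmin i = m%:R ^+ k.
Hypothesis prod_wmax : \prod_i wmax i = (m%:R ^+ k)^-1.

(** Let M = m^k and let z be the sum. Then M z is the sum of the v j, and Cauchy-Schwarz against the
    constant family 1 gives M^2 z^* z <= M [sqnorm v], which is at most M^2 times the product of the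
    q i. *)
Lemma sum_prod_le : psd ((\prod_i q i)%:S
  - adj (\sum_j \prod_(i <- enum 'I_r) x i j) * \sum_j \prod_(i <- enum 'I_r) x i j).
Proof.
have enum_lt : pairwise (fun i i' : 'I_r => (i < i')%N) (enum 'I_r).
  rewrite -[pairwise _ _](pairwise_map (fun i : 'I_r => i : nat) ltn).
  rewrite val_enum_ord.
  rewrite -sorted_pairwise; [exact: iota_ltn_sorted | exact: ltn_trans].
have M0 : m%:R ^+ k != 0 :> R by rewrite expf_neq0 // pnatr_eq0 -lt0n.
have M_ge0 : 0 <= m%:R ^+ k :> R by rewrite exprn_ge0.
have := @sum_prod_vrec [::] (enum 'I_r) enum_lt.
rewrite big_enum prod_wmin /=; under [RHS]eq_bigr do rewrite big_nil mul1r.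
set z := \sum_j \prod_(i <- enum 'I_r) x i j; set M := m%:R ^+ k in M0 M_ge0 *.
move=> zE; have := sqnorm_vrec_le enum_lt; rewrite big_enum !big_split /= prod_wmin prod_wmax.
rewrite mulfK //; set v := vrec _ in zE * => v_le.
have ones : psd (M%:S - \sum_(j : {ffun 'I_k -> 'I_m}) (1 : mult A) * adj 1).
  rewrite adj1 mulr1 sumr_const card_ffun !card_ord -[X in _ - X]scaler_nat.
  rewrite natrX subrr; exact: psd0.
have := cauchy_schwarz v M_ge0 ones.
have -> : \sum_j 1 * v j = \sum_j v j by apply: eq_bigr => j _; rewrite mul1r.
rewrite -zE -/(sqnorm v) => cs; have := psdD (psdZ M_ge0 v_le) cs.
rewrite scalerBr subrKA adjZ mscaleAl mscaleAr !scalerA.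
have MV : 0 <= M^-1 ^+ 2 by rewrite exprn_ge0 ?invr_ge0.
move/(psdZ MV); rewrite scalerBr !scalerA.
have -> : M^-1 ^+ 2 * (M * ((\prod_i q i) * M)) = \prod_i q i by field.
have -> : M^-1 ^+ 2 * (M * M) = 1 by field.
by rewrite scale1r.
Qed.

End Recursion.

(** * Minima and maxima of blocks *)

Section BlockGeometry.
Context {r k : nat}.
Variables (S : {set 'I_r}) (B : 'I_k -> {set 'I_r}) (l : 'I_r -> 'I_k).
Implicit Types (i : 'I_r) (b : 'I_k).

Lemma block_min_le (D : {set 'I_r}) i : i \in D -> (block_min D <= i)%N.
Proof.
rewrite /block_min => iD; have := mem_index_enum i.
elim: (index_enum _) => [//|i' s IH]; rewrite in_cons big_cons => /predU1P[<-|/IH le_i].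
  by rewrite iD geq_minl.
by case: ifP => // _; rewrite geq_min le_i orbT.
Qed.

Lemma le_block_min (D : {set 'I_r}) i :
  (forall i', i' \in D -> (i <= i')%N) -> (i <= block_min D)%N.
Proof.
(* The default value r is admissible because every position is below r. *)
move=> le_i; rewrite /block_min; elim/big_ind: _ => //; first exact: ltnW.
by move=> a b ia ib; rewrite leq_min ia.
Qed.

Lemma block_max_le (D : {set 'I_r}) i :
  (forall i', i' \in D -> (i' <= i)%N) -> (block_max D <= i)%N.
Proof. by move=> le_i; apply/bigmax_leqP. Qed.

Hypothesis Binj : injective B.
Hypothesis Bpart : finset.partition [set B b | b : 'I_k] S.
Hypothesis hl : forall i, i \in S -> i \in B (l i).

Lemma block_sub b i : i \in B b -> i \in S.
Proof.
move=> iB; rewrite -(finset.cover_partition Bpart); apply/finset.bigcupP.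
by exists (B b) => //; apply: imset_f.
Qed.

Lemma block_index b i : i \in B b -> l i = b.
Proof.
move=> iB; have iB' := hl (block_sub iB); apply: Binj.
have /finset.trivIsetP tI := finset.partition_trivIset Bpart.
apply/eqP; apply: contraT => neq.
have := tI _ _ (imset_f B (isT : l i \in 'I_k)) (imset_f B (isT : b \in 'I_k)) neq.
by move/pred0P/(_ i); rewrite /= iB iB'.
Qed.

(** Parametrized by the order, so that [leq] gives minima, [geq] maxima, and both are counted at
    once. *)
Definition extremal (le : rel nat) i : bool :=
  (i \in S) && [forall i' in B (l i), le i i'].

Lemma extremalP (le : rel nat) i : reflect
  (i \in S /\ forall i', i' \in B (l i) -> le i i') (extremal le i).
Proof. by apply: (iffP andP) => -[iS /forall_inP]. Qed.

(** [l] maps the extremal positions bijectively onto the blocks. *)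
Lemma card_extremal (le : rel nat) : antisymmetric le ->
    (forall b, exists2 i, i \in B b & forall i', i' \in B b -> le i i') ->
  #|extremal le| = k.
Proof.
move=> le_anti ex_min; rewrite -[RHS]card_ord -cardsT.
have -> : [set: 'I_k] = l @: [set i | extremal le i].
  apply/setP => b; rewrite inE; apply/esym/imsetP.
  have [i iB i_le] := ex_min b; exists i; last by rewrite (block_index iB).
  by rewrite inE; apply/extremalP; rewrite (block_index iB) (block_sub iB).
rewrite card_in_imset ?cardsE // => i i'; rewrite !inE.
move=> /extremalP[iS i_le] /extremalP[i'S i'_le] eq_l; apply: val_inj => /=.
by apply: le_anti; rewrite i_le ?i'_le //= ?eq_l ?hl // -eq_l hl.
Qed.

Hypothesis Bcard : forall b, #|B b| = 1%N \/ #|B b| = 2%N.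

Lemma block_neq0 b : exists i, i \in B b.
Proof. by apply/card_gt0P; case: (Bcard b) => ->. Qed.

Lemma card_min : #|extremal leq| = k.
Proof.
apply: card_extremal => [|b]; first exact: anti_leq.
have [i iB] := block_neq0 b.
by case: (arg_minnP (fun i : 'I_r => i : nat) iB) => i' i'B i'_le; exists i'.
Qed.

Lemma card_max : #|extremal geq| = k.
Proof.
apply: card_extremal => [a b /andP[/= ba ab]|b]; first by apply/anti_leq/andP.
have [i iB] := block_neq0 b.
by case: (arg_maxnP (fun i : 'I_r => i : nat) iB) => i' i'B i'_le; exists i'.
Qed.

Lemma min_block_min i : i \in S -> extremal leq i = (i == block_min (B (l i)) :> nat).
Proof.
move=> iS; have min_le := block_min_le (hl iS).
apply/extremalP/eqP => [[_ i_le]|i_eq].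
  by apply/eqP; rewrite eqn_leq min_le andbT le_block_min.
by split=> // i' /block_min_le; rewrite -i_eq.
Qed.

Lemma single_extremal i : i \in S -> #|B (l i)| = 1%N ->
  extremal leq i /\ extremal geq i.
Proof.
move=> iS /eqP/cards1P[a Ba]; have := hl iS; rewrite Ba inE => /eqP ia.
split; apply/extremalP; split=> // i'; rewrite Ba inE => /eqP->;
  by rewrite ia /geq /= leqnn.
Qed.

Lemma pair_extremal i : i \in S -> #|B (l i)| = 2%N ->
  extremal geq i = ~~ extremal leq i.
Proof.
move=> iS /eqP/cards2P[a [b [ab Bab]]]; have := hl iS; rewrite Bab => iB.
have ext (le : rel nat) : extremal le i = le i a && le i b.
  apply/extremalP/andP => [[_ i_le]|[ia ib]].
    by rewrite !i_le // Bab !inE eqxx ?orbT.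
  by split=> // i'; rewrite Bab !inE => /orP[]/eqP->.
move: ab; rewrite !ext -val_eqE; move: iB; rewrite !inE => /orP[]/eqP-> /=.
  by rewrite !leqnn /= -ltnNge ltn_neqAle eq_sym => ->.
by rewrite !leqnn !andbT -ltnNge ltn_neqAle => ->.
Qed.

End BlockGeometry.

(** * Independence of the factors from colours of blocks that are not open *)

Section BlockIndependence.
Context {R : realType} {A : cstarAlgType R} {r k m : nat}.
Variables (S : {set 'I_r}) (B : 'I_k -> {set 'I_r}) (l : 'I_r -> 'I_k).
Variable X : 'I_r -> {ffun 'I_k -> 'I_m} -> A.
Hypothesis Binj : injective B.
Hypothesis Bpart : finset.partition [set B b | b : 'I_k] S.
Hypothesis hl : forall i, i \in S -> i \in B (l i).
Hypothesis hX : forall i : 'I_r, i \in S -> forall j j' : {ffun 'I_k -> 'I_m},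
  j (l i) = j' (l i) -> X i j = X i j'.
Hypothesis Xopen : is_open S B X.
Implicit Types (i : 'I_r) (j : {ffun 'I_k -> 'I_m}).

(** For i' in S the updated coordinate belongs to another block; for i' in T the openness of X
    applies. *)
Lemma indep_of_not_open i i' j c : i \in S -> i' \notin B (l i) ->
  ~~ open_at (B (l i)) i' -> X i' (upd j (l i) c) = X i' j.
Proof.
move=> iS i'B not_open; have [i'S|i'S] := boolP (i' \in S).
  apply: hX => //; apply: upd_other; apply: contraNneq i'B => <-; exact: hl.
apply: Xopen => // b b_open; apply: upd_other.
by apply: contraNneq not_open => <-.
Qed.

Lemma indep_left_of_min i i' j c : extremal S B l leq i -> (i' < i)%N ->
  X i' (upd j (l i) c) = X i' j.
Proof.
move=> i_min lt_i; have /extremalP[iS i_le] := i_min.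
apply: indep_of_not_open => //.
  by apply: contraL lt_i => /i_le; rewrite -leqNgt.
by rewrite /open_at negb_and -leqNgt; have := i_min; rewrite (min_block_min hl iS) =>
  /eqP <-; rewrite (ltnW lt_i).
Qed.

Lemma indep_right_of_max i i' j c : extremal S B l geq i -> (i < i')%N ->
  X i' (upd j (l i) c) = X i' j.
Proof.
move=> /extremalP[iS i_ge] lt_i; apply: indep_of_not_open => //.
  by apply: contraL lt_i => /i_ge; rewrite -leqNgt.
rewrite /open_at negb_and -!leqNgt; apply/orP; right.
by apply: leq_trans (ltnW lt_i); apply: block_max_le.
Qed.

Lemma upd_col i j c : i \in S -> X i (upd j (l i) c) = Xcol X i c.
Proof. by move=> iS; apply: hX => //; rewrite upd_same ffunE. Qed.

End BlockIndependence.

(** * From norms in A to operator inequalities *)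

Section NormBounds.
Context {R : realType} {A : cstarAlgType R}.
Local Notation "a %:S" := (a *: (1 : mult A)) (at level 1, left associativity, format "a %:S").

Lemma psd_cnormC (a : A) : adj (lmul a) = lmul a -> psd ((cnorm a)%:S - lmul a).
Proof.
move=> a_adj; apply: psd_subC; rewrite ?cnorm_ge0 //.
by apply/bd_lmul; rewrite ?cnorm_ge0.
Qed.

Lemma psd_cnorm_sum (I : finType) (a : I -> A) : (forall i, adj (lmul (a i)) = lmul (a i)) ->
  psd ((cnorm (\sum_i a i))%:S - \sum_i lmul (a i)).
Proof.
move=> a_adj; rewrite -lmul_sum; apply: psd_cnormC.
by rewrite lmul_sum adj_sum; apply: eq_bigr.
Qed.

(** [sum_polar_le] with c = |a_i| and d = |a_i^*|; the constant is the square of [Q] at a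
    singleton. *)
Lemma psd_single (I : finType) (a : I -> A) :
  psd ((cnorm (\sum_i csqrt (a i ** star (a i)))
        * cnorm (\sum_i csqrt (star (a i) ** a i)))%:S
    - adj (\sum_i lmul (a i)) * \sum_i lmul (a i)).
Proof.
have c_spec i := csqrt_spec (a i).
have d_spec i := csqrt_spec (star (a i)).
apply: (@sum_polar_le _ _ _ _ (fun i => lmul (csqrt (star (a i) ** a i)))
  (fun i => lmul (csqrt (a i ** star (a i))))); rewrite ?cnorm_ge0 //.
- by move=> i; case: (c_spec i).
- by move=> i; case: (d_spec i); rewrite starK.
- by move=> i; case: (c_spec i).
- by move=> i; case: (d_spec i); rewrite starK lmul_star adjK.
- by apply: psd_cnorm_sum => i; apply: psd_adj; case: (d_spec i); rewrite starK.
- by apply: psd_cnorm_sum => i; apply: psd_adj; case: (c_spec i).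
Qed.

Lemma lmul_cprod (a : A) (s : seq A) :
  lmul (cprod (a :: s)) = \prod_(b <- a :: s) lmul b.
Proof.
rewrite /=; elim: s a => [|b s IH] a; first by rewrite big_seq1.
by rewrite /= IH !big_cons lmulM mulrA.
Qed.

End NormBounds.

(** * The recursion applied to [lmul (X i j)] with weights [Q i ^+ 2] *)

Theorem theorem4p1 (R : realType) (A : cstarAlgType R) (r k m : nat)
  (hk : (1 <= k)%N) (hkr : (k <= r)%N) (hm : (1 <= m)%N)
  (S : {set 'I_r}) (B : 'I_k -> {set 'I_r})
  (Binj : injective B)
  (Bpart : finset.partition [set B b | b : 'I_k] S)
  (Bcard : forall b : 'I_k, #|B b| = 1%N \/ #|B b| = 2%N)
  (l : 'I_r -> 'I_k)
  (hl : forall i : 'I_r, i \in S -> i \in B (l i))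
  (X : 'I_r -> {ffun 'I_k -> 'I_m} -> A)
  (hX : forall i : 'I_r, i \in S -> forall j j' : {ffun 'I_k -> 'I_m},
    j (l i) = j' (l i) -> X i j = X i j')
  (Xopen : is_open S B X) :
  cnorm (\sum_(j : {ffun 'I_k -> 'I_m}) cprod [seq X i j | i <- enum 'I_r])
    <= \prod_(i < r) Q S B l X i.
Proof.
have Q_ge0 i : 0 <= Q S B l X i.
  rewrite /Q; case: ifP => _; last by do 2?case: ifP => _; rewrite ?mulr_ge0 ?sqrtr_ge0.
  by elim/big_ind: _ => [//|a b a0 b0|j _]; rewrite ?le_max ?a0 ?cnorm_ge0.
set x := fun i j => lmul (X i j).
have cprodE j : lmul (cprod [seq X i j | i <- enum 'I_r]) = \prod_(i <- enum 'I_r) x i j.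
  (* Since 1 <= k <= r, the dummy value of [cprod] is not reached. *)
  have : (0 < size (enum 'I_r))%N by rewrite size_enum_ord (leq_trans hk).
  case: (enum _) => [//|i s] _.
  by rewrite [map _ _]/= lmul_cprod -(big_map (X^~ j) xpredT) map_cons.
have prod_ge0 : 0 <= \prod_i Q S B l X i by apply: prodr_ge0.
(* By the C*-identity it suffices to bound the adjoint square of the sum by the product of the
   squared [Q]. *)
apply/bd_lmul => //; apply: bd_sqr => //.
rewrite lmul_sum (eq_bigr _ (fun j _ => cprodE j)) -prodrXl.
apply: bd_of_psdC; [by apply: prodr_ge0 => i _; apply: sqr_ge0 | exact: psd_adjM |].
have inS i : extremal S B l leq i || extremal S B l geq i -> i \in S.
  by case/orP => /andP[].
(* Singletons are the positions that are both minimal and maximal; this matches the branches of [Q]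
   with the cases of the recursion. *)
have card_cases i : i \in S -> (#|B (l i)| == 1%N) =
    (extremal S B l leq i && extremal S B l geq i).
  move=> iS; case: (Bcard (l i)) => card_B; rewrite card_B.
    by have [-> ->] := single_extremal hl iS card_B.
  by rewrite (pair_extremal hl iS card_B) andbN.
have notS i : ~~ extremal S B l leq i -> ~~ extremal S B l geq i -> i \notin S.
  move=> i_min i_max; apply/negP => iS; case: (Bcard (l i)) => card_B.
    by have [i_min' _] := single_extremal hl iS card_B; rewrite i_min' in i_min.
  by rewrite (pair_extremal hl iS card_B) i_min in i_max.
apply: (@sum_prod_le _ _ _ _ _ (extremal S B l leq) (extremal S B l geq) l).
- exact: hm.
- by move=> i i' j c i_min i'_lt; rewrite /x (indep_left_of_min hl hX Xopen).
- by move=> i i' j c i_max i'_gt; rewrite /x (indep_right_of_max hl hX Xopen).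
- by move=> i; apply: sqr_ge0.
- move=> i j i_min i_max; have iS := notS i i_min i_max.
  have Xle : cnorm (X i j) <= Q S B l X i by rewrite /Q iS le_bigmax.
  have bdX : bd (Q S B l X i) (x i j) by apply/bd_lmul.
  apply: psd_subC; rewrite ?sqr_ge0 ?adjM ?adjK // expr2.
  by apply: bdM => //; apply: bd_adj.
- move=> i j i_min i_max; have iS : i \in S by rewrite inS ?i_max ?orbT.
  rewrite /Q iS card_cases // (negPf i_min) -(min_block_min hl iS) (negPf i_min).
  rewrite sqr_sqrtr ?cnorm_ge0 //.
  rewrite [X in _ - X](eq_bigr (fun c => lmul (star (Xcol X i c) ** Xcol X i c))).
    by apply: psd_cnorm_sum => c; rewrite -lmul_star starM starK.
  by move=> c _; rewrite /x (upd_col hX) // lmulM lmul_star.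
- move=> i j i_min i_max; have iS : i \in S by rewrite inS ?i_min.
  rewrite /Q iS card_cases // (negPf i_max) andbF -(min_block_min hl iS) i_min.
  rewrite sqr_sqrtr ?cnorm_ge0 //.
  rewrite [X in _ - X](eq_bigr (fun c => lmul (Xcol X i c ** star (Xcol X i c)))).
    by apply: psd_cnorm_sum => c; rewrite -lmul_star starM starK.
  by move=> c _; rewrite /x (upd_col hX) // lmulM lmul_star.
- move=> i j i_min i_max; have iS : i \in S by rewrite inS ?i_min.
  rewrite /Q iS card_cases // i_min i_max exprMn !sqr_sqrtr ?cnorm_ge0 //.
  rewrite (eq_bigr (fun c => lmul (Xcol X i c))); first exact: psd_single.
  by move=> c _; rewrite /x (upd_col hX).
(* Each block has one minimum and one maximum, hence k factors of each weight. *)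
- rewrite -big_mkcond prodr_const; congr (_ ^+ _).
  exact: (card_min Binj Bpart hl Bcard).
- rewrite -big_mkcond prodr_const exprVn; congr (_ ^+ _)^-1.
  exact: (card_max Binj Bpart hl Bcard).
Qed.
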